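(* (i) Let $M$ be a log-convex weight sequence. Then $v_M$ is essential, and in fact $v_M=\widetilde{v_M}$. (ii) Let $u$ be a weight. Then the following are equivalent: (a) $u$ is essential; (b) $u\sim v_{M^u}$.
   Context: A weight is a function $v:[0,+\infty)\to(0,+\infty)$ that is continuous, non-increasing and rapidly decreasing, i.e. $\lim_{t\to+\infty}t^kv(t)=0$ for all $k\ge0$. $H(\mathbb{C})$ is the space of entire functions. $\mathbb{N}=\{0,1,2,\dots\}$. For positive functions $v,w$ on $[0,+\infty)$, $v\preceq w$ means: there is $C\ge1$ with $w(t)\le Cv(t)$ for all $t\ge0$; $v\sim w$ means $v\preceq w$ and $w\preceq v$. For a weight $v$ put $w_v:=1/v$, $B_{w_v}(\mathbb{C}):=\{f\in H(\mathbb{C}):|f(z)|\le w_v(|z|)\ \forall z\in\mathbb{C}\}$, $\widetilde{w_v}(z):=\sup\{|f(z)|:f\in B_{w_v}(\mathbb{C})\}$ (a radial function, regarded as a function of $|z|$), and $\widetilde{v}:=1/\widetilde{w_v}$. The weight $v$ is essential if $v\sim\widetilde v$. A weight sequence is $M=(M_j)_{j\in\mathbb{N}}$ with $M_j>0$, $M_0=1$ and $\lim_{j\to+\infty}(M_j)^{1/j}=+\infty$. It is log-convex if $M_j^2\le M_{j-1}M_{j+1}$ for all $j\ge1$. For a sequence $M$ of positive reals with $(M_j)^{1/j}\to+\infty$ put $\omega_M(t):=\sup_{j\in\mathbb{N}}\log(t^j/M_j)$ for $t>0$, $\omega_M(0):=0$, and $v_M(t):=\exp(-\omega_M(t))$.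 For a weight $u$, the associated sequence $M^u=(M^u_j)_{j\in\mathbb{N}}$ is $M^u_j:=\sup_{t>0}t^ju(t)$, and $v_{M^u}(t)=\exp(-\omega_{M^u}(t))$. *)

(* Defs.v *)
From Stdlib Require Import Reals Lra.
From Coquelicot Require Import Coquelicot.
Open Scope R_scope.

(* Functions on [0,+oo) are modelled as functions R -> R of which only the
   values at t >= 0 matter; [continuous_on] is relative to [0,+oo), so
   continuity at 0 is one-sided. *)
Definition is_weight (v : R -> R) : Prop :=
  (forall t, 0 <= t -> 0 < v t) /\
  continuous_on (fun t => 0 <= t) v /\
  (forall s t, 0 <= s -> s <= t -> v t <= v s) /\
  (forall k : nat, is_lim (fun t => t ^ k * v t) p_infty 0).

(* Note the direction: [preceq v w] bounds w by a multiple of v. *)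
Definition preceq (v w : R -> R) : Prop :=
  exists C : R, 1 <= C /\ forall t, 0 <= t -> w t <= C * v t.

Definition sim (v w : R -> R) : Prop := preceq v w /\ preceq w v.

(* [ex_derive] is taken over the field C: complex differentiability. *)
Definition entire (f : C -> C) : Prop :=
  forall z : C, @ex_derive C_AbsRing C_NormedModule f z.

Definition w_of (v : R -> R) (t : R) : R := / v t.

Definition unit_ball (w : R -> R) (f : C -> C) : Prop :=
  entire f /\ forall z : C, Cmod (f z) <= w (Cmod z).

(* For a weight v the supremum is finite: it is taken over a nonempty set
   bounded by w_of v (Cmod z). *)
Definition w_tilde (v : R -> R) (z : C) : R :=
  real (Lub_Rbar (fun y : R =>
    exists f : C -> C, unit_ball (w_of v) f /\ y = Cmod (f z))).

(* [w_tilde v] is radial (see [w_tilde_radial] below), so it is determined by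
   its values on the nonnegative real axis. *)
Definition v_tilde (v : R -> R) (t : R) : R := / w_tilde v (RtoC t).

Definition essential (v : R -> R) : Prop := is_weight v /\ sim v (v_tilde v).

Definition is_weight_sequence (M : nat -> R) : Prop :=
  (forall j, 0 < M j) /\
  M 0%nat = 1 /\
  is_lim_seq (fun j => Rpower (M j) (/ INR j)) p_infty.

Definition log_convex (M : nat -> R) : Prop :=
  forall j : nat, (1 <= j)%nat -> M j ^ 2 <= M (j - 1)%nat * M (j + 1)%nat.

(* The supremum is finite as soon as M is positive and (M_j)^(1/j) -> +oo. *)
Definition omega (M : nat -> R) (t : R) : R :=
  if Rlt_dec 0 t
  then real (Sup_seq (fun j => Finite (ln (t ^ j / M j))))
  else 0.

Definition v_seq (M : nat -> R) (t : R) : R := exp (- omega M t).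

(* The supremum is finite when u is a weight. *)
Definition assoc_seq (u : R -> R) (j : nat) : R :=
  real (Lub_Rbar (fun y : R => exists t : R, 0 < t /\ y = t ^ j * u t)).

Lemma unit_ball_rot (w : R -> R) (f : C -> C) (a : C) :
  Cmod a = 1 -> unit_ball w f -> unit_ball w (fun z => f (Cmult a z)).
Proof.
intros Ha [Hf Hb]; split.
- intros z.
  apply (@ex_derive_comp C_AbsRing C_NormedModule f (fun z : C => Cmult a z) z).
  + apply Hf.
  + eexists; apply (@is_derive_mult C_AbsRing (fun _ => a) (fun x => x) z).
    * apply (@is_derive_const C_AbsRing).
    * apply (@is_derive_id C_AbsRing).
    * apply Cmult_comm.
- intros z; specialize (Hb (Cmult a z)).
  rewrite Cmod_mult, Ha, Rmult_1_l in Hb; exact Hb.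
Qed.

Lemma w_tilde_radial (v : R -> R) (z : C) :
  w_tilde v z = w_tilde v (RtoC (Cmod z)).
Proof.
assert (H : exists a b : C, Cmod a = 1 /\ Cmod b = 1 /\
              Cmult a z = RtoC (Cmod z) /\ Cmult b (RtoC (Cmod z)) = z).
{ destruct (Ceq_dec z 0) as [->|Hz].
  - exists 1%C, 1%C; rewrite !Cmod_1, Cmod_0, Cmult_1_l; auto.
  - assert (Hr : RtoC (Cmod z) <> 0%C).
    { intros E; apply RtoC_inj in E; apply Cmod_eq_0 in E; auto. }
    assert (Hp : Cmod z <> 0).
    { intros E; apply Hr; rewrite E; reflexivity. }
    assert (Hm : Cmod (RtoC (Cmod z)) = Cmod z).
    { rewrite Cmod_R; apply Rabs_pos_eq, Cmod_ge_0. }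
    exists (RtoC (Cmod z) / z)%C, (z / RtoC (Cmod z))%C.
    repeat split.
    + rewrite Cmod_div by assumption; rewrite Hm; field; assumption.
    + rewrite Cmod_div by assumption; rewrite Hm; field; assumption.
    + field; assumption.
    + field; assumption. }
destruct H as (a & b & Ha & Hb & Haz & Hbz).
unfold w_tilde; f_equal; apply Lub_Rbar_eqset; intros y; split;
  intros (f & Hf & ->).
- exists (fun x => f (Cmult b x)); split.
  + apply unit_ball_rot; assumption.
  + rewrite Hbz; reflexivity.
- exists (fun x => f (Cmult a x)); split.
  + apply unit_ball_rot; assumption.
  + rewrite Haz; reflexivity.
Qed.

(* Main.v *)
Require Import Defs.
From Stdlib Require Import Reals Lra Lia Psatz Classical.
From Coquelicot Require Import Coquelicot.
Open Scope R_scope.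

(** Write [mu M t] for the supremum of [t ^ j / M j] over [j], so that
    [v_seq M t = / mu M t] for [t > 0].

    In (i) the monomials [z ^ j / M j] belong to the unit ball of
    [1 / v_seq M] by the very definition of [mu], and their supremum at [t] is
    [mu M t]; hence the associated growth condition loses nothing
    ([v_tilde_v_seq]). That [v_seq M] is a weight rests on a Lipschitz estimate
    for [mu M] on bounded intervals ([v_seq_lipschitz]).

    In (ii) put [M = assoc_seq u]. Again [z ^ j / M j] is in the unit ball of
    [1 / u], so [mu M <= w_tilde u <= 1 / u], and if [1 / u] is bounded by a
    multiple of [mu M] then it is bounded by a multiple of [w_tilde u]. For the
    converse it suffices that [w_tilde u <= 8 * mu M]
    ([unit_ball_le_v_seq_assoc]). Coefficient estimates alone would only bound
    [w_tilde u] by the sum of the terms, which can be much larger than the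
    largest one. Instead choose, for every [j], a radius at which
    [s ^ j * u s] is at least half of its supremum [M j]. Two such radii
    [r <= t < R'] belong to consecutive degrees [j] and [j + 1]. On the circle of
    radius [r] the bound [1 / u] is comparable to the monomial of degree [j], on
    the circle of radius [R'] to that of degree [j + 1], and the holomorphic
    functions [f / z ^ j] and [f / z ^ (j + 1)] transport these bounds to [t].

    This transport needs the Cauchy formula in an annulus for functions that are
    merely complex differentiable. Goursat's subdivision argument is carried out
    for pairs of real functions on rectangles ([flux_eq_0], and
    [flux_eq_0_punctured] with one exceptional point). In the coordinates
    [z = exp (s + i theta)] it says that the mean of a holomorphic function over a
    circle (its real part, to be precise) does not depend on the radius ([circle_integral_const]), the two
    horizontal sides of the rectangle cancelling by periodicity. Applied to the
    difference quotient of [g] at [t] this gives the Cauchy estimate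
    [cauchy_annulus_bound], and applied to powers of [g] the maximum principle
    [maximum_principle_annulus]. *)

(** * Goursat's lemma on rectangles *)

(** The flux of the vector field [(P, - Q)] out of a rectangle, that is, the
    integral of [P dy + Q dx] along its boundary, counterclockwise. *)
Definition flux (P Q : R -> R -> R) (x1 x2 y1 y2 : R) : R :=
  (RInt (P x2) y1 y2 - RInt (P x1) y1 y2)
  - (RInt (fun x => Q x y2) x1 x2 - RInt (fun x => Q x y1) x1 x2).

(** [P dy + Q dx] is closed at the point, in the pointwise sense
    [dP/dx = dQ/dy], with both functions differentiable there. *)
Definition conjugate_at (P Q : R -> R -> R) (x y : R) : Prop :=
  exists a b c : R,
    differentiable_pt_lim P x y a b /\ differentiable_pt_lim Q x y c a.

Lemma conjugate_at_continuous (P Q : R -> R -> R) (x y : R) :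
  conjugate_at P Q x y ->
  continuous (P x) y /\ continuous (fun s => Q s y) x.
Proof.
intros (a & b & c & HP & HQ).
assert (HP' : continuity_2d_pt P x y)
  by (apply differentiable_continuity_pt; exists a, b; exact HP).
assert (HQ' : continuity_2d_pt Q x y)
  by (apply differentiable_continuity_pt; exists c, a; exact HQ).
split; apply continuity_pt_filterlim; apply continuity_pt_locally; intros eps.
- destruct (HP' eps) as [d Hd]; exists d; intros v Hv; apply Hd.
  + rewrite Rminus_diag, Rabs_R0; apply cond_pos.
  + exact Hv.
- destruct (HQ' eps) as [d Hd]; exists d; intros v Hv; apply Hd.
  + exact Hv.
  + rewrite Rminus_diag, Rabs_R0; apply cond_pos.
Qed.

Lemma ex_RInt_vertical (P Q : R -> R -> R) (x y1 y2 : R) :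
  y1 <= y2 -> (forall y, y1 <= y <= y2 -> conjugate_at P Q x y) ->
  ex_RInt (P x) y1 y2.
Proof.
intros Hy H; apply (ex_RInt_continuous (V := R_CompleteNormedModule)).
rewrite Rmin_left, Rmax_right by assumption; intros z Hz.
exact (proj1 (conjugate_at_continuous _ _ _ _ (H z Hz))).
Qed.

Lemma ex_RInt_horizontal (P Q : R -> R -> R) (x1 x2 y : R) :
  x1 <= x2 -> (forall x, x1 <= x <= x2 -> conjugate_at P Q x y) ->
  ex_RInt (fun x => Q x y) x1 x2.
Proof.
intros Hx H; apply (ex_RInt_continuous (V := R_CompleteNormedModule)).
rewrite Rmin_left, Rmax_right by assumption; intros z Hz.
exact (proj2 (conjugate_at_continuous _ _ _ _ (H z Hz))).
Qed.

Lemma RInt_split (f : R -> R) (a b c : R) :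
  ex_RInt f a c -> a <= b -> b <= c ->
  RInt f a c = RInt f a b + RInt f b c.
Proof.
intros H Hab Hbc; symmetry.
apply (RInt_Chasles (V := R_CompleteNormedModule) f a b c).
- apply (ex_RInt_Chasles_1 (V := R_CompleteNormedModule) f a b c); [ lra | exact H ].
- apply (ex_RInt_Chasles_2 (V := R_CompleteNormedModule) f a b c); [ lra | exact H ].
Qed.

Lemma flux_split_x (P Q : R -> R -> R) (x1 x2 x3 y1 y2 : R) :
  x1 <= x2 -> x2 <= x3 ->
  ex_RInt (fun x => Q x y1) x1 x3 -> ex_RInt (fun x => Q x y2) x1 x3 ->
  flux P Q x1 x3 y1 y2 = flux P Q x1 x2 y1 y2 + flux P Q x2 x3 y1 y2.
Proof.
intros H12 H23 H1 H2; unfold flux.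
rewrite (RInt_split _ x1 x2 x3 H1 H12 H23), (RInt_split _ x1 x2 x3 H2 H12 H23).
ring.
Qed.

Lemma flux_split_y (P Q : R -> R -> R) (x1 x2 y1 y2 y3 : R) :
  y1 <= y2 -> y2 <= y3 ->
  ex_RInt (P x1) y1 y3 -> ex_RInt (P x2) y1 y3 ->
  flux P Q x1 x2 y1 y3 = flux P Q x1 x2 y1 y2 + flux P Q x1 x2 y2 y3.
Proof.
intros H12 H23 H1 H2; unfold flux.
rewrite (RInt_split _ y1 y2 y3 H1 H12 H23), (RInt_split _ y1 y2 y3 H2 H12 H23).
ring.
Qed.

Lemma RInt_increment_bound (f g : R -> R) (a b k E : R) :
  a <= b -> ex_RInt f a b -> ex_RInt g a b ->
  (forall t, a <= t <= b -> Rabs (g t - f t - k) <= E) ->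
  Rabs (RInt g a b - RInt f a b - k * (b - a)) <= (b - a) * E.
Proof.
intros Hab Hf Hg HE.
assert (Hk : ex_RInt (fun _ : R => k) a b)
  by apply (ex_RInt_const (V := R_NormedModule)).
assert (Hgf : ex_RInt (fun t => g t - f t) a b)
  by (apply (ex_RInt_minus (V := R_NormedModule)); assumption).
replace (RInt g a b - RInt f a b - k * (b - a))
  with (RInt (fun t => g t - f t - k) a b).
- apply abs_RInt_le_const; [ exact Hab | | exact HE ].
  apply (ex_RInt_minus (V := R_NormedModule)); assumption.
- rewrite (RInt_minus (V := R_CompleteNormedModule) (fun t => g t - f t) (fun _ => k))
    by assumption.
  rewrite (RInt_minus (V := R_CompleteNormedModule) g f) by assumption.
  rewrite (RInt_const (V := R_CompleteNormedModule)).
  unfold minus, plus, opp, scal; simpl; unfold mult; simpl; ring.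
Qed.

(** The affine parts of the two functions contribute [a * area] and
    [- a * area], so only their errors are seen by the flux. *)
Lemma flux_affine_bound (P Q : R -> R -> R) (x1 x2 y1 y2 px py a b c E : R) :
  x1 <= x2 -> y1 <= y2 ->
  (forall x y, x1 <= x <= x2 -> y1 <= y <= y2 -> conjugate_at P Q x y) ->
  (forall x y, x1 <= x <= x2 -> y1 <= y <= y2 ->
     Rabs (P x y - P px py - (a * (x - px) + b * (y - py))) <= E /\
     Rabs (Q x y - Q px py - (c * (x - px) + a * (y - py))) <= E) ->
  Rabs (flux P Q x1 x2 y1 y2) <= 2 * E * ((x2 - x1) + (y2 - y1)).
Proof.
intros Hx Hy Hc HE.
assert (HP : Rabs (RInt (P x2) y1 y2 - RInt (P x1) y1 y2
                   - a * (x2 - x1) * (y2 - y1)) <= (y2 - y1) * (2 * E)).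
{ apply RInt_increment_bound; [ exact Hy | | | ].
  1,2: apply (ex_RInt_vertical P Q); [ exact Hy | intros y Hy'; apply Hc; lra ].
  intros y Hy'.
  generalize (proj1 (HE x1 y ltac:(lra) Hy')) (proj1 (HE x2 y ltac:(lra) Hy')).
  intros H1%Rabs_le_between H2%Rabs_le_between; apply Rabs_le; lra. }
assert (HQ : Rabs (RInt (fun x => Q x y2) x1 x2 - RInt (fun x => Q x y1) x1 x2
                   - a * (y2 - y1) * (x2 - x1)) <= (x2 - x1) * (2 * E)).
{ apply (RInt_increment_bound (fun x => Q x y1) (fun x => Q x y2));
    [ exact Hx | | | ].
  1,2: apply (ex_RInt_horizontal P Q); [ exact Hx | intros x Hx'; apply Hc; lra ].
  intros x Hx'.
  generalize (proj2 (HE x y1 Hx' ltac:(lra))) (proj2 (HE x y2 Hx' ltac:(lra))).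
  intros H1%Rabs_le_between H2%Rabs_le_between; apply Rabs_le; lra. }
unfold flux.
apply Rabs_le_between in HP; apply Rabs_le_between in HQ; apply Rabs_le; lra.
Qed.

(** Along a nested sequence of quarters, a nonzero flux would stay at least
    proportional to the area, while [conjugate_at] at the limit point makes it
    of smaller order. *)
Lemma flux_eq_0 (P Q : R -> R -> R) (x1 x2 y1 y2 : R) :
  x1 <= x2 -> y1 <= y2 ->
  (forall x y, x1 <= x <= x2 -> y1 <= y <= y2 -> conjugate_at P Q x y) ->
  flux P Q x1 x2 y1 y2 = 0.
Proof.
intros Hx Hy Hc.
set (w := fun n : nat => (x2 - x1) * / 2 ^ n).
set (h := fun n : nat => (y2 - y1) * / 2 ^ n).
assert (Hpow : forall n, 0 < / 2 ^ n)
  by (intros n; apply Rinv_0_lt_compat, pow_lt; lra).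
assert (HwS : forall n, w n = 2 * w (S n)).
{ intros n; unfold w; simpl; field; apply pow_nonzero; lra. }
assert (HhS : forall n, h n = 2 * h (S n)).
{ intros n; unfold h; simpl; field; apply pow_nonzero; lra. }
assert (Hw0 : forall n, 0 <= w n)
  by (intros n; apply Rmult_le_pos; [ lra | left; apply Hpow ]).
assert (Hh0 : forall n, 0 <= h n)
  by (intros n; apply Rmult_le_pos; [ lra | left; apply Hpow ]).
set (inside := fun n (p : R * R) =>
  x1 <= fst p /\ fst p + w n <= x2 /\ y1 <= snd p /\ snd p + h n <= y2).
set (fl := fun n (p : R * R) =>
  flux P Q (fst p) (fst p + w n) (snd p) (snd p + h n)).
(* One of the four quarters carries at least a quarter of the flux. *)
assert (Hstep : forall n p, { q : R * R | inside n p ->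
   inside (S n) q /\ fst p <= fst q /\ fst q + w (S n) <= fst p + w n /\
   snd p <= snd q /\ snd q + h (S n) <= snd p + h n /\
   Rabs (fl n p) <= 4 * Rabs (fl (S n) q) }).
{ intros n [x y].
  set (q1 := (x, y)); set (q2 := (x + w (S n), y)).
  set (q3 := (x, y + h (S n))); set (q4 := (x + w (S n), y + h (S n))).
  assert (Hq : inside n (x, y) ->
    fl n (x, y) = fl (S n) q1 + fl (S n) q2 + fl (S n) q3 + fl (S n) q4).
  { intros (H1 & H2 & H3 & H4); simpl in H1, H2, H3, H4.
    generalize (HwS n) (HhS n) (Hw0 (S n)) (Hh0 (S n)); intros E1 E2 E3 E4.
    unfold fl; simpl.
    assert (Hh : forall y', y <= y' <= y + h n ->
                   ex_RInt (fun x => Q x y') x (x + w n)).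
    { intros y' Hy'; apply (ex_RInt_horizontal P Q); [ lra | ].
      intros x' Hx'; apply Hc; lra. }
    assert (Hv : forall x', x <= x' <= x + w n -> ex_RInt (P x') y (y + h n)).
    { intros x' Hx'; apply (ex_RInt_vertical P Q); [ lra | ].
      intros y' Hy'; apply Hc; lra. }
    replace (x + w (S n) + w (S n)) with (x + w n) by lra.
    replace (y + h (S n) + h (S n)) with (y + h n) by lra.
    rewrite (flux_split_x P Q x (x + w (S n)) (x + w n)) by
      (try lra; apply Hh; lra).
    rewrite !(flux_split_y P Q _ _ y (y + h (S n)) (y + h n)) by
      (try lra; apply Hv; lra).
    ring. }
  assert (Hin : inside n (x, y) -> inside (S n) q1 /\ inside (S n) q2 /\
            inside (S n) q3 /\ inside (S n) q4).
  { generalize (HwS n) (HhS n) (Hw0 (S n)) (Hh0 (S n)); intros E1 E2 E3 E4.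
    unfold inside; simpl; intros; lra. }
  assert (Htri : inside n (x, y) -> Rabs (fl n (x, y)) <=
    Rabs (fl (S n) q1) + Rabs (fl (S n) q2) + Rabs (fl (S n) q3)
    + Rabs (fl (S n) q4)).
  { intros H; rewrite (Hq H).
    eapply Rle_trans; [ apply Rabs_triang | ]; apply Rplus_le_compat_r.
    eapply Rle_trans; [ apply Rabs_triang | ]; apply Rplus_le_compat_r.
    apply Rabs_triang. }
  generalize (HwS n) (HhS n) (Hw0 (S n)) (Hh0 (S n)); intros E1 E2 E3 E4.
  destruct (Rle_dec (Rabs (fl n (x, y))) (4 * Rabs (fl (S n) q1))) as [L1|L1];
    [ exists q1 | ].
  2: destruct (Rle_dec (Rabs (fl n (x, y))) (4 * Rabs (fl (S n) q2))) as [L2|L2];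
    [ exists q2 | ].
  3: destruct (Rle_dec (Rabs (fl n (x, y))) (4 * Rabs (fl (S n) q3))) as [L3|L3];
    [ exists q3 | exists q4 ].
  all: intros H; generalize (Hin H) (Htri H); intros (I1 & I2 & I3 & I4) HT.
  all: split; [ assumption | ].
  all: unfold q1, q2, q3, q4 in *; cbn [fst snd]; repeat split; lra. }
set (p := fix p (n : nat) : R * R :=
  match n with O => (x1, y1) | S k => proj1_sig (Hstep k (p k)) end).
assert (Hin : forall n, inside n (p n)).
{ induction n as [|n IH].
  - unfold inside, w, h; simpl; lra.
  - exact (proj1 (proj2_sig (Hstep n (p n)) IH)). }
assert (Hnext := fun n => proj2 (proj2_sig (Hstep n (p n)) (Hin n))).
change (forall n, fst (p n) <= fst (p (S n)) /\
  fst (p (S n)) + w (S n) <= fst (p n) + w n /\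
  snd (p n) <= snd (p (S n)) /\ snd (p (S n)) + h (S n) <= snd (p n) + h n /\
  Rabs (fl n (p n)) <= 4 * Rabs (fl (S n) (p (S n)))) in Hnext.
assert (Hfl : forall n, Rabs (fl 0%nat (p 0%nat)) <= 4 ^ n * Rabs (fl n (p n))).
{ induction n as [|n IH]; [ simpl; lra | ].
  destruct (Hnext n) as (_ & _ & _ & _ & H).
  apply Rle_trans with (1 := IH); simpl.
  rewrite (Rmult_comm 4), Rmult_assoc; apply Rmult_le_compat_l; [ | exact H ].
  apply pow_le; lra. }
assert (Hmono : forall n k, fst (p n) <= fst (p (n + k)%nat) /\
  fst (p (n + k)%nat) + w (n + k)%nat <= fst (p n) + w n /\
  snd (p n) <= snd (p (n + k)%nat) /\
  snd (p (n + k)%nat) + h (n + k)%nat <= snd (p n) + h n).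
{ intros n; induction k as [|k IH].
  - rewrite Nat.add_0_r; lra.
  - rewrite Nat.add_succ_r; destruct (Hnext (n + k)%nat) as (A & B & C & D & _).
    lra. }
assert (Hcross : forall n m,
  fst (p n) <= fst (p m) + w m /\ snd (p n) <= snd (p m) + h m).
{ intros n m; destruct (Nat.le_ge_cases n m) as [L|L].
  - destruct (Hmono n (m - n)%nat) as (A & B & C & D).
    replace (n + (m - n))%nat with m in A, B, C, D by lia.
    generalize (Hw0 m) (Hh0 m); lra.
  - destruct (Hmono m (n - m)%nat) as (A & B & C & D).
    replace (m + (n - m))%nat with n in A, B, C, D by lia.
    generalize (Hw0 n) (Hh0 n); lra. }
assert (Hlim : exists a b, forall n,
  fst (p n) <= a <= fst (p n) + w n /\ snd (p n) <= b <= snd (p n) + h n).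
{ destruct (completeness (fun z => exists n, z = fst (p n))) as [a [Ha Ha']].
  - exists (fst (p 0%nat) + w 0%nat); intros z [n ->]; apply Hcross.
  - exists (fst (p 0%nat)), 0%nat; reflexivity.
  - destruct (completeness (fun z => exists n, z = snd (p n))) as [b [Hb Hb']].
    + exists (snd (p 0%nat) + h 0%nat); intros z [n ->]; apply Hcross.
    + exists (snd (p 0%nat)), 0%nat; reflexivity.
    + exists a, b; intros n; repeat split.
      * apply Ha; exists n; reflexivity.
      * apply Ha'; intros z [m ->]; apply Hcross.
      * apply Hb; exists n; reflexivity.
      * apply Hb'; intros z [m ->]; apply Hcross. }
destruct Hlim as (px & py & Hp).
assert (Hpin : x1 <= px <= x2 /\ y1 <= py <= y2).
{ generalize (Hp 0%nat); unfold w, h; simpl; lra. }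
destruct (Hc px py (proj1 Hpin) (proj2 Hpin)) as (a & b & c & HP & HQ).
set (D := (x2 - x1) + (y2 - y1)).
assert (Hsmall : forall eps : posreal,
  Rabs (flux P Q x1 x2 y1 y2) <= eps * (2 * D ^ 2)).
{ intros eps.
  destruct (HP eps) as [d1 H1]; destruct (HQ eps) as [d2 H2].
  assert (Hn : exists n, D * / 2 ^ n < Rmin d1 d2).
  { destruct (pow_lt_1_zero (/ 2)
       ltac:(rewrite Rabs_pos_eq; lra) (Rmin d1 d2 / (D + 1))) as [n Hn].
    - apply Rdiv_lt_0_compat; [ apply Rmin_case; apply cond_pos | unfold D; lra ].
    - exists n; specialize (Hn n (le_n n)).
      rewrite pow_inv, Rabs_pos_eq in Hn by (left; apply Hpow).
      apply Rlt_div_r in Hn; [ | unfold D; lra ].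
      generalize (Hpow n); intros; unfold D in *; nra. }
  destruct Hn as [n Hn].
  assert (Hwh : w n + h n = D * / 2 ^ n) by (unfold w, h, D; ring).
  assert (Hd1 := Rmin_l d1 d2); assert (Hd2 := Rmin_r d1 d2).
  generalize (Hw0 n) (Hh0 n) (Hp n) (Hin n); intros W1 W2 W3 W4.
  unfold inside in W4.
  assert (Hbd : Rabs (fl n (p n)) <= 2 * (eps * (w n + h n)) * (w n + h n)).
  { unfold fl.
    replace (2 * (eps * (w n + h n)) * (w n + h n)) with
      (2 * (eps * (w n + h n)) *
        ((fst (p n) + w n - fst (p n)) + (snd (p n) + h n - snd (p n)))) by ring.
    apply (flux_affine_bound P Q _ _ _ _ px py a b c); [ lra | lra | | ].
    - intros x y Hx' Hy'; apply Hc; lra.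
    - intros x y Hx' Hy'.
      assert (Ax : Rabs (x - px) <= w n + h n) by (apply Rabs_le; lra).
      assert (Ay : Rabs (y - py) <= w n + h n) by (apply Rabs_le; lra).
      assert (Am : eps * Rmax (Rabs (x - px)) (Rabs (y - py)) <= eps * (w n + h n))
        by (apply Rmult_le_compat_l;
            [ left; apply cond_pos | apply Rmax_lub; assumption ]).
      split; (eapply Rle_trans; [ | exact Am ]); [ apply H1 | apply H2 ]; lra. }
  replace (flux P Q x1 x2 y1 y2) with (fl 0%nat (p 0%nat)).
  - apply Rle_trans with (1 := Hfl n).
    apply Rle_trans with (4 ^ n * (2 * (eps * (w n + h n)) * (w n + h n))).
    + apply Rmult_le_compat_l; [ apply pow_le; lra | exact Hbd ].
    + rewrite Hwh; replace 4 with (2 * 2) by ring; rewrite Rpow_mult_distr.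
      right; field; apply pow_nonzero; lra.
  - unfold fl, w, h; simpl; f_equal; field. }
apply Rabs_eq_0; apply Rle_antisym; [ | apply Rabs_pos ].
apply le_epsilon; intros e He.
assert (HD : 0 < 2 * D ^ 2 + 1) by (generalize (pow2_ge_0 D); lra).
assert (He' : 0 < e / (2 * D ^ 2 + 1)) by (apply Rdiv_lt_0_compat; lra).
apply Rle_trans with (1 := Hsmall (mkposreal _ He')); cbn [pos].
rewrite Rplus_0_l; apply Rle_trans with (e / (2 * D ^ 2 + 1) * (2 * D ^ 2 + 1)).
- apply Rmult_le_compat_l; lra.
- right; field; lra.
Qed.

(** Cutting off a small square around the exceptional point leaves four
    rectangles without flux, and the flux of the square is at most a
    constant times its perimeter. *)
Lemma flux_eq_0_punctured (P Q : R -> R -> R) (x1 x2 y1 y2 px py K d : R) :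
  x1 < px < x2 -> y1 < py < y2 -> 0 < d ->
  (forall x y, x1 <= x <= x2 -> y1 <= y <= y2 -> x <> px \/ y <> py ->
     conjugate_at P Q x y) ->
  (forall x y, Rabs (x - px) < d -> Rabs (y - py) < d ->
     x <> px \/ y <> py -> Rabs (P x y) <= K /\ Rabs (Q x y) <= K) ->
  flux P Q x1 x2 y1 y2 = 0.
Proof.
intros Hx Hy Hd Hc HK.
assert (HK0 : 0 <= K).
{ destruct (HK (px + d / 2) py) as [H _].
  - replace (px + d / 2 - px) with (d / 2) by ring; rewrite Rabs_pos_eq; lra.
  - rewrite Rminus_diag, Rabs_R0; exact Hd.
  - left; lra.
  - generalize (Rabs_pos (P (px + d / 2) py)); lra. }
assert (Hsq : forall e, 0 < e -> e < d -> e < px - x1 -> e < x2 - px ->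
  e < py - y1 -> e < y2 - py -> Rabs (flux P Q x1 x2 y1 y2) <= e * (8 * K)).
{ intros e He0 He1 He2 He3 He4 He5.
  assert (Hh : forall y, y1 <= y <= y2 -> y <> py -> forall a b,
    x1 <= a -> a <= b -> b <= x2 -> ex_RInt (fun x => Q x y) a b).
  { intros y Hy' Hn a b Ha Hab Hb; apply (ex_RInt_horizontal P Q); [ lra | ].
    intros x Hx'; apply Hc; [ lra | lra | right; exact Hn ]. }
  assert (Hv : forall x, x1 <= x <= x2 -> x <> px -> forall a b,
    y1 <= a -> a <= b -> b <= y2 -> ex_RInt (P x) a b).
  { intros x Hx' Hn a b Ha Hab Hb; apply (ex_RInt_vertical P Q); [ lra | ].
    intros y Hy'; apply Hc; [ lra | lra | left; exact Hn ]. }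
  rewrite (flux_split_x P Q x1 (px - e) x2) by (try lra; apply Hh; lra).
  rewrite (flux_split_x P Q (px - e) (px + e) x2) by (try lra; apply Hh; lra).
  rewrite (flux_split_y P Q (px - e) (px + e) y1 (py - e) y2)
    by (try lra; apply Hv; lra).
  rewrite (flux_split_y P Q (px - e) (px + e) (py - e) (py + e) y2)
    by (try lra; apply Hv; lra).
  rewrite (flux_eq_0 P Q x1 (px - e)) by
    (try lra; intros; apply Hc; try lra; left; lra).
  rewrite (flux_eq_0 P Q (px + e) x2) by
    (try lra; intros; apply Hc; try lra; left; lra).
  rewrite (flux_eq_0 P Q (px - e) (px + e) y1 (py - e)) by
    (try lra; intros; apply Hc; try lra; right; lra).
  rewrite (flux_eq_0 P Q (px - e) (px + e) (py + e) y2) by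
    (try lra; intros; apply Hc; try lra; right; lra).
  assert (Hin : forall a c, c - e <= a <= c + e -> Rabs (a - c) < d)
    by (intros a c Ha; apply Rabs_lt_between; lra).
  assert (B1 : Rabs (RInt (P (px + e)) (py - e) (py + e))
               <= (py + e - (py - e)) * K).
  { apply abs_RInt_le_const; [ lra | apply Hv; lra | ].
    intros y Hy'; apply HK; [ apply Hin; lra | apply Hin; lra | left; lra ]. }
  assert (B2 : Rabs (RInt (P (px - e)) (py - e) (py + e))
               <= (py + e - (py - e)) * K).
  { apply abs_RInt_le_const; [ lra | apply Hv; lra | ].
    intros y Hy'; apply HK; [ apply Hin; lra | apply Hin; lra | left; lra ]. }
  assert (B3 : Rabs (RInt (fun x => Q x (py + e)) (px - e) (px + e))
               <= (px + e - (px - e)) * K).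
  { apply abs_RInt_le_const; [ lra | apply Hh; lra | ].
    intros x Hx'; apply HK; [ apply Hin; lra | apply Hin; lra | right; lra ]. }
  assert (B4 : Rabs (RInt (fun x => Q x (py - e)) (px - e) (px + e))
               <= (px + e - (px - e)) * K).
  { apply abs_RInt_le_const; [ lra | apply Hh; lra | ].
    intros x Hx'; apply HK; [ apply Hin; lra | apply Hin; lra | right; lra ]. }
  apply Rabs_le_between in B1; apply Rabs_le_between in B2.
  apply Rabs_le_between in B3; apply Rabs_le_between in B4.
  unfold flux; apply Rabs_le; lra. }
apply Rabs_eq_0; apply Rle_antisym; [ | apply Rabs_pos ].
apply le_epsilon; intros eps Heps; rewrite Rplus_0_l.
set (m := Rmin d (Rmin (Rmin (px - x1) (x2 - px)) (Rmin (py - y1) (y2 - py)))).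
assert (Hm0 : 0 < m) by (unfold m; repeat apply Rmin_pos; lra).
assert (Hm : m <= d /\ m <= px - x1 /\ m <= x2 - px /\ m <= py - y1 /\ m <= y2 - py).
{ unfold m.
  generalize (Rmin_l d (Rmin (Rmin (px - x1) (x2 - px)) (Rmin (py - y1) (y2 - py))))
    (Rmin_r d (Rmin (Rmin (px - x1) (x2 - px)) (Rmin (py - y1) (y2 - py))))
    (Rmin_l (Rmin (px - x1) (x2 - px)) (Rmin (py - y1) (y2 - py)))
    (Rmin_r (Rmin (px - x1) (x2 - px)) (Rmin (py - y1) (y2 - py)))
    (Rmin_l (px - x1) (x2 - px)) (Rmin_r (px - x1) (x2 - px))
    (Rmin_l (py - y1) (y2 - py)) (Rmin_r (py - y1) (y2 - py)); lra. }
set (e := Rmin (m / 2) (eps / (8 * K + 1))).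
assert (He1 := Rmin_l (m / 2) (eps / (8 * K + 1))).
assert (He2 := Rmin_r (m / 2) (eps / (8 * K + 1))); fold e in He1, He2.
assert (He0 : 0 < e)
  by (unfold e; apply Rmin_pos; [ lra | apply Rdiv_lt_0_compat; lra ]).
apply Rle_trans with (e * (8 * K)); [ apply Hsq; lra | ].
apply Rle_div_r in He2; [ nra | lra ].
Qed.

(** * Complex differentiability *)

(** The derivative is taken in the module structure that C has as a ring, the
    one in which the product rule is available; [entire_iff] relates it to the
    structure used for entire functions. *)
Definition holomorphic_at (f : C -> C) (z : C) : Prop :=
  @ex_derive C_AbsRing (AbsRing_NormedModule C_AbsRing) f z.

Lemma is_derive_C_elim (f : C -> C) (z l : C) :
  @is_derive C_AbsRing C_NormedModule f z l ->
  forall eps : posreal, exists delta : posreal, forall w : C,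
    Cmod (w - z) < delta ->
    Cmod (f w - f z - (w - z) * l) <= eps * Cmod (w - z).
Proof.
intros [_ H] eps; destruct (H z (fun P HP => HP) eps) as [d Hd].
exists d; intros w Hw; exact (Hd w Hw).
Qed.

Lemma is_derive_C_elim' (f : C -> C) (z l : C) :
  @is_derive C_AbsRing (AbsRing_NormedModule C_AbsRing) f z l ->
  forall eps : posreal, exists delta : posreal, forall w : C,
    Cmod (w - z) < delta ->
    Cmod (f w - f z - (w - z) * l) <= eps * Cmod (w - z).
Proof.
intros [_ H] eps; destruct (H z (fun P HP => HP) eps) as [d Hd].
exists d; intros w Hw; exact (Hd w Hw).
Qed.

Lemma is_derive_C_intro (f : C -> C) (z l : C) :
  (forall eps : posreal, exists delta : posreal, forall w : C,
    Cmod (w - z) < delta ->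
    Cmod (f w - f z - (w - z) * l) <= eps * Cmod (w - z)) ->
  @is_derive C_AbsRing (AbsRing_NormedModule C_AbsRing) f z l.
Proof.
intros H; split.
- apply (@is_linear_scal_l C_AbsRing (AbsRing_NormedModule C_AbsRing)).
- intros x Hx eps.
  apply (@is_filter_lim_locally_unique C_AbsRing
           (AbsRing_NormedModule C_AbsRing)) in Hx.
  rewrite <- Hx; destruct (H eps) as [d Hd].
  exists d; intros w Hw; exact (Hd w Hw).
Qed.

Lemma is_derive_C_intro' (f : C -> C) (z l : C) :
  (forall eps : posreal, exists delta : posreal, forall w : C,
    Cmod (w - z) < delta ->
    Cmod (f w - f z - (w - z) * l) <= eps * Cmod (w - z)) ->
  @is_derive C_AbsRing C_NormedModule f z l.
Proof.
intros H; split.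
- apply (@is_linear_scal_l C_AbsRing C_NormedModule).
- intros x Hx eps.
  apply (@is_filter_lim_locally_unique C_AbsRing
           (AbsRing_NormedModule C_AbsRing)) in Hx.
  rewrite <- Hx; destruct (H eps) as [d Hd].
  exists d; intros w Hw; exact (Hd w Hw).
Qed.

(** The two normed-module structures of C over itself have the same norm but
    are not convertible, so derivatives pass from one to the other through
    their characterisation by [Cmod]. *)
Lemma entire_iff (f : C -> C) : entire f <-> forall z, holomorphic_at f z.
Proof.
split; intros H z; destruct (H z) as [l Hl]; exists l.
- apply is_derive_C_intro, is_derive_C_elim, Hl.
- apply is_derive_C_intro', is_derive_C_elim', Hl.
Qed.

Lemma holomorphic_at_const (c z : C) : holomorphic_at (fun _ => c) z.
Proof.
exists (zero : C_Ring).
apply (@is_derive_const C_AbsRing (AbsRing_NormedModule C_AbsRing)).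
Qed.

Lemma holomorphic_at_id (z : C) : holomorphic_at (fun x => x) z.
Proof. exists (one : C_Ring); apply (@is_derive_id C_AbsRing). Qed.

Lemma holomorphic_at_mult (f g : C -> C) (z : C) :
  holomorphic_at f z -> holomorphic_at g z ->
  holomorphic_at (fun x => f x * g x)%C z.
Proof.
intros [a Ha] [b Hb].
exact (ex_intro _ _ (@is_derive_mult C_AbsRing f g z a b Ha Hb Cmult_comm)).
Qed.

Lemma holomorphic_at_minus (f g : C -> C) (z : C) :
  holomorphic_at f z -> holomorphic_at g z ->
  holomorphic_at (fun x => f x - g x)%C z.
Proof.
intros [a Ha] [b Hb].
exact (ex_intro _ _ (@is_derive_minus C_AbsRing (AbsRing_NormedModule C_AbsRing)
  f g z a b Ha Hb)).
Qed.

Lemma holomorphic_at_pow (f : C -> C) (n : nat) (z : C) :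
  holomorphic_at f z -> holomorphic_at (fun x => f x ^ n)%C z.
Proof.
intros Hf; induction n as [|n IH].
- exact (holomorphic_at_const 1%C z).
- exact (holomorphic_at_mult f (fun x => f x ^ n)%C z Hf IH).
Qed.

Lemma is_derive_Cinv (z : C) :
  z <> 0%C ->
  @is_derive C_AbsRing (AbsRing_NormedModule C_AbsRing) Cinv z (- / (z * z))%C.
Proof.
intros Hz; apply is_derive_C_intro; intros eps.
assert (Hm : 0 < Cmod z) by (apply Cmod_gt_0; exact Hz).
assert (Hd : 0 < Rmin (Cmod z / 2) (eps * Cmod z ^ 3 / 2)).
{ apply Rmin_pos; [ lra | ].
  apply Rdiv_lt_0_compat; [ | lra ].
  apply Rmult_lt_0_compat; [ apply cond_pos | apply pow_lt, Hm ]. }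
exists (mkposreal _ Hd); simpl; intros w Hw.
assert (Hw1 := Rlt_le_trans _ _ _ Hw (Rmin_l _ _)).
assert (Hw2 := Rlt_le_trans _ _ _ Hw (Rmin_r _ _)).
assert (Hwm : Cmod z / 2 <= Cmod w).
{ assert (H : Cmod z <= Cmod w + Cmod (w - z)).
  { replace z with (w + - (w - z))%C at 1 by ring.
    eapply Rle_trans; [ apply Cmod_triangle | rewrite Cmod_opp; lra ]. }
  lra. }
assert (Hw0 : w <> 0%C) by (apply Cmod_gt_0; lra).
replace (/ w - / z - (w - z) * - / (z * z))%C
  with ((w - z) * ((w - z) / (w * (z * z))))%C by (field; auto).
rewrite Cmod_mult, Rmult_comm; apply Rmult_le_compat_r; [ apply Cmod_ge_0 | ].
assert (Hzz : (z * z <> 0)%C) by (apply Cmult_neq_0; assumption).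
rewrite Cmod_div by (apply Cmult_neq_0; assumption).
rewrite !Cmod_mult.
assert (Hp : 0 < Cmod w * (Cmod z * Cmod z))
  by (apply Rmult_lt_0_compat; [ lra | apply Rmult_lt_0_compat; lra ]).
apply Rle_div_l; [ exact Hp | ].
apply Rle_trans with (eps * Cmod z ^ 3 / 2); [ lra | ].
replace (eps * Cmod z ^ 3 / 2) with (eps * (Cmod z / 2 * (Cmod z * Cmod z))) by
  (simpl; field).
apply Rmult_le_compat_l; [ left; apply cond_pos | ].
apply Rmult_le_compat_r; [ nra | exact Hwm ].
Qed.

Lemma holomorphic_at_div (f g : C -> C) (z : C) :
  g z <> 0%C -> holomorphic_at f z -> holomorphic_at g z ->
  holomorphic_at (fun x => f x / g x)%C z.
Proof.
intros H0 Hf [b Hb]; apply (holomorphic_at_mult f (fun x => / g x)%C z Hf).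
exact (ex_intro _ _ (@is_derive_comp C_AbsRing (AbsRing_NormedModule C_AbsRing)
  Cinv g z _ _ (is_derive_Cinv (g z) H0) Hb)).
Qed.

(** The Cauchy-Riemann equations: [p + i q] is the complex derivative. *)
Lemma holomorphic_at_differentiable (f : C -> C) (x y : R) :
  holomorphic_at f (x, y) ->
  exists p q : R,
    differentiable_pt_lim (fun u v => Re (f (u, v))) x y p (- q) /\
    differentiable_pt_lim (fun u v => Im (f (u, v))) x y q p.
Proof.
intros [[p q] H]; exists p, q.
assert (H' : forall eps : posreal, exists d : posreal, forall u v,
  Rabs (u - x) < d -> Rabs (v - y) < d ->
  Cmod (f (u, v) - f (x, y) - ((u, v) - (x, y)) * (p, q)) <=
    eps * Rmax (Rabs (u - x)) (Rabs (v - y))).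
{ intros eps.
  assert (Hs2 : 0 < sqrt 2) by (apply sqrt_lt_R0; lra).
  assert (He : 0 < eps / sqrt 2) by
    (apply Rdiv_lt_0_compat; [ apply cond_pos | exact Hs2 ]).
  destruct (is_derive_C_elim' f _ _ H (mkposreal _ He)) as [d Hd].
  simpl in Hd.
  assert (Hd' : 0 < d / sqrt 2) by
    (apply Rdiv_lt_0_compat; [ apply cond_pos | exact Hs2 ]).
  exists (mkposreal _ Hd'); simpl; intros u v Hu Hv.
  assert (Hm := Cmod_2Rmax ((u, v) - (x, y))%C); simpl in Hm.
  change (u + - x) with (u - x) in Hm; change (v + - y) with (v - y) in Hm.
  eapply Rle_trans; [ apply Hd | ].
  - apply Rle_lt_trans with (1 := Hm).
    rewrite Rmult_comm; apply Rlt_div_r; [ exact Hs2 | ].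
    apply Rmax_case; assumption.
  - apply Rle_trans with
      (eps / sqrt 2 * (sqrt 2 * Rmax (Rabs (u - x)) (Rabs (v - y)))).
    + apply Rmult_le_compat_l; [ lra | exact Hm ].
    + right; field; lra. }
split; intros eps; destruct (H' eps) as [d Hd]; exists d; intros u v Hu Hv;
  (eapply Rle_trans; [ | apply (Hd u v Hu Hv) ]).
- eapply Rle_trans; [ | apply re_le_Cmod ].
  right; f_equal; unfold Re; simpl; ring.
- eapply Rle_trans; [ | eapply Rle_trans; [ apply Rmax_r | apply Rmax_Cmod ] ].
  right; f_equal; unfold Im; simpl; ring.
Qed.

(** * Integrals over circles *)

Definition polar (r theta : R) : C := (r * cos theta, r * sin theta).

Lemma Cmod_polar (r theta : R) : 0 <= r -> Cmod (polar r theta) = r.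
Proof.
intros Hr; unfold Cmod, polar; simpl fst; simpl snd.
rewrite <- (sqrt_pow2 r Hr) at 3; f_equal.
generalize (sin2_cos2 theta); unfold Rsqr; intros H.
replace ((r * cos theta) ^ 2 + (r * sin theta) ^ 2)
  with (r ^ 2 * (sin theta * sin theta + cos theta * cos theta)) by ring.
rewrite H; ring.
Qed.

Lemma polar_injective_at_0 (r t theta : R) :
  0 < r -> 0 < t -> - PI <= theta <= PI -> polar r theta = RtoC t ->
  r = t /\ theta = 0.
Proof.
intros Hr Ht Hth H.
assert (Hrt : r = t).
{ rewrite <- (Cmod_polar r theta) by lra; rewrite H, Cmod_R, Rabs_pos_eq; lra. }
split; [ exact Hrt | ].
apply (f_equal snd) in H as Hs; apply (f_equal fst) in H; simpl in H, Hs.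
assert (Hs0 : sin theta = 0) by nra.
assert (Hc : cos theta = 1) by nra.
destruct (Rtotal_order theta 0) as [L|[L|L]]; [ | exact L | ].
- destruct (Req_dec theta (- PI)) as [->|Hn].
  + rewrite cos_neg, cos_PI in Hc; lra.
  + assert (0 < sin (- theta)) by (apply sin_gt_0; lra).
    rewrite sin_neg in *; lra.
- destruct (Req_dec theta PI) as [->|Hn].
  + rewrite cos_PI in Hc; lra.
  + assert (0 < sin theta) by (apply sin_gt_0; lra); lra.
Qed.

Lemma differentiable_pt_lim_separated (f g : R -> R) (x y a b : R) :
  is_derive f x a -> is_derive g y b ->
  differentiable_pt_lim (fun u v => f u * g v) x y (a * g y) (f x * b).
Proof.
intros Hf Hg.
assert (H1 : differentiable_pt_lim (fun u _ => f u) x y a 0)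
  by (apply differentiable_pt_lim_proj1_0, is_derive_Reals, Hf).
assert (H2 : differentiable_pt_lim (fun _ v => g v) x y 0 b).
{ intros eps.
  destruct (differentiable_pt_lim_proj1_0 g y x b
              (proj1 (is_derive_Reals _ _ _) Hg) eps) as [d Hd].
  exists d; intros u v Hu Hv; specialize (Hd v u Hv Hu).
  rewrite Rmax_comm; eapply Rle_trans; [ | exact Hd ].
  right; f_equal; ring. }
assert (H3 : differentiable_pt_lim Rmult (f x) (g y) (g y) (f x)).
{ intros eps; exists eps; intros u v Hu Hv.
  replace (u * v - f x * g y - (g y * (u - f x) + f x * (v - g y)))
    with ((u - f x) * (v - g y)) by ring.
  rewrite Rabs_mult; apply Rmult_le_compat; try apply Rabs_pos.
  - lra.
  - apply Rmax_r. }
generalize (differentiable_pt_lim_comp Rmult _ _ x y _ _ _ _ _ _ H3 H1 H2).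
replace (g y * a + f x * 0) with (a * g y) by ring.
replace (g y * 0 + f x * b) with (f x * b) by ring.
exact (fun H => H).
Qed.

Lemma polar_exp_differentiable (s theta : R) :
  differentiable_pt_lim (fun u v => exp u * cos v) s theta
    (exp s * cos theta) (exp s * - sin theta) /\
  differentiable_pt_lim (fun u v => exp u * sin v) s theta
    (exp s * sin theta) (exp s * cos theta).
Proof.
split; apply differentiable_pt_lim_separated.
- apply is_derive_exp.
- apply is_derive_cos.
- apply is_derive_exp.
- apply is_derive_sin.
Qed.

(** In the coordinates [z = exp (s + i theta)] a holomorphic function is again
    holomorphic, and one of the two Cauchy-Riemann equations is
    [conjugate_at]. *)
Lemma holomorphic_at_conjugate_at (f : C -> C) (s theta : R) :
  holomorphic_at f (polar (exp s) theta) ->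
  conjugate_at (fun s theta => Re (f (polar (exp s) theta)))
    (fun s theta => Im (f (polar (exp s) theta))) s theta.
Proof.
intros H.
destruct (holomorphic_at_differentiable _ _ _ H) as (p & q & Hre & Him).
destruct (polar_exp_differentiable s theta) as [Hc Hs].
exists (p * (exp s * cos theta) + - q * (exp s * sin theta)).
exists (p * (exp s * - sin theta) + - q * (exp s * cos theta)).
exists (q * (exp s * cos theta) + p * (exp s * sin theta)).
split.
- exact (differentiable_pt_lim_comp (fun u v => Re (f (u, v)))
    _ _ s theta _ _ _ _ _ _ Hre Hc Hs).
- replace (p * (exp s * cos theta) + - q * (exp s * sin theta))
    with (q * (exp s * - sin theta) + p * (exp s * cos theta)) by ring.
  exact (differentiable_pt_lim_comp (fun u v => Im (f (u, v)))
    _ _ s theta _ _ _ _ _ _ Him Hc Hs).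
Qed.

(** Real parts suffice: a rotation of the values recovers the modulus, see
    [cauchy_annulus_bound]. *)
Definition circle_integral (f : C -> C) (r : R) : R :=
  RInt (fun theta => Re (f (polar r theta))) (- PI) PI.

(** The horizontal sides [theta = - PI] and [theta = PI] give the same points of
    the plane, so only the two circles are left in the flux. *)
Lemma circle_integral_flux (f : C -> C) (r r' : R) :
  0 < r -> 0 < r' ->
  circle_integral f r' - circle_integral f r =
  flux (fun s theta => Re (f (polar (exp s) theta)))
    (fun s theta => Im (f (polar (exp s) theta))) (ln r) (ln r') (- PI) PI.
Proof.
intros Hr Hr'; unfold flux; rewrite !exp_ln by assumption.
unfold circle_integral.
rewrite (RInt_ext (fun x => Im (f (polar (exp x) PI)))
  (fun x => Im (f (polar (exp x) (- PI)))) (ln r) (ln r')); [ ring | ].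
intros x _; unfold polar; rewrite cos_neg, sin_neg, sin_PI, Ropp_0.
reflexivity.
Qed.

Lemma exp_monotone (x y : R) : x <= y -> exp x <= exp y.
Proof. intros [H| ->]; [ left; apply exp_increasing, H | lra ]. Qed.

Lemma exp_between_ln (r r' s : R) :
  0 < r -> 0 < r' -> ln r <= s <= ln r' -> r <= exp s <= r'.
Proof.
intros Hr Hr' Hs; rewrite <- (exp_ln r Hr) at 1; rewrite <- (exp_ln r' Hr').
split; apply exp_monotone; lra.
Qed.

Lemma circle_integral_const (f : C -> C) (r r' : R) :
  0 < r -> r <= r' ->
  (forall z, r <= Cmod z <= r' -> holomorphic_at f z) ->
  circle_integral f r = circle_integral f r'.
Proof.
intros Hr Hrr Hf; symmetry; apply Rminus_diag_uniq.
rewrite circle_integral_flux by lra; apply flux_eq_0.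
- apply ln_le; assumption.
- generalize PI_RGT_0; lra.
- intros s theta Hs _; apply holomorphic_at_conjugate_at, Hf.
  rewrite Cmod_polar by (left; apply exp_pos).
  apply exp_between_ln; lra.
Qed.

Lemma circle_integral_const_punctured (f : C -> C) (t r r' K d : R) :
  0 < r -> r < t -> t < r' -> 0 < d ->
  (forall z, r <= Cmod z <= r' -> z <> RtoC t -> holomorphic_at f z) ->
  (forall z, z <> RtoC t -> Cmod (z - t) < d -> Cmod (f z) <= K) ->
  circle_integral f r = circle_integral f r'.
Proof.
intros Hr Hrt Htr Hd Hf HK; symmetry; apply Rminus_diag_uniq.
rewrite circle_integral_flux by lra.
assert (HPI := PI_RGT_0).
assert (Hne : forall s theta, - PI <= theta <= PI -> s <> ln t \/ theta <> 0 ->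
  polar (exp s) theta <> RtoC t).
{ intros s theta Hth Hor E.
  destruct (polar_injective_at_0 (exp s) t theta (exp_pos s) ltac:(lra) Hth E)
    as [E1 E2].
  destruct Hor as [Hor|Hor]; [ | contradiction ].
  apply Hor; rewrite <- E1; symmetry; apply ln_exp. }
destruct (polar_exp_differentiable (ln t) 0) as [Hc Hs].
assert (Hc' : continuity_2d_pt (fun u v => exp u * cos v) (ln t) 0)
  by (apply differentiable_continuity_pt; eexists; eexists; exact Hc).
assert (Hs' : continuity_2d_pt (fun u v => exp u * sin v) (ln t) 0)
  by (apply differentiable_continuity_pt; eexists; eexists; exact Hs).
assert (Hd2 : 0 < d / 2) by lra.
destruct (Hc' (mkposreal _ Hd2)) as [d1 H1].
destruct (Hs' (mkposreal _ Hd2)) as [d2 H2]; simpl in H1, H2.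
rewrite exp_ln in H1, H2 by lra.
rewrite cos_0, Rmult_1_r in H1; rewrite sin_0, Rmult_0_r in H2.
apply (flux_eq_0_punctured _ _ _ _ _ _ (ln t) 0 K (Rmin PI (Rmin d1 d2))).
- split; apply ln_increasing; lra.
- lra.
- apply Rmin_pos; [ lra | apply Rmin_pos; apply cond_pos ].
- intros s theta Hs1 Hth Hor; apply holomorphic_at_conjugate_at, Hf.
  + rewrite Cmod_polar by (left; apply exp_pos).
    apply exp_between_ln; lra.
  + apply Hne; assumption.
- intros s theta Hs1 Hth Hor.
  assert (M1 := Rmin_l PI (Rmin d1 d2)); assert (M2 := Rmin_r PI (Rmin d1 d2)).
  assert (M3 := Rmin_l d1 d2); assert (M4 := Rmin_r d1 d2).
  assert (Hfz : Cmod (f (polar (exp s) theta)) <= K).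
  { apply HK.
    - apply Hne; [ | exact Hor ].
      rewrite Rminus_0_r in Hth; apply Rabs_lt_between in Hth; lra.
    - apply Rle_lt_trans with (Cmod (RtoC (exp s * cos theta - t)) +
        Cmod (Ci * RtoC (exp s * sin theta - 0))).
      + eapply Rle_trans; [ right | apply Cmod_triangle ]; f_equal.
        unfold polar, Ci, RtoC, Cminus, Cplus, Cmult, Copp; simpl.
        f_equal; ring.
      + rewrite Cmod_mult, Cmod_Ci, Rmult_1_l, !Cmod_R.
        generalize (H1 s theta ltac:(lra) ltac:(lra)).
        generalize (H2 s theta ltac:(lra) ltac:(lra)); lra. }
  split; (eapply Rle_trans; [ | exact Hfz ]).
  + apply re_le_Cmod.
  + eapply Rle_trans; [ apply Rmax_r | apply Rmax_Cmod ].
Qed.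

Lemma ex_circle_integral (f : C -> C) (r : R) :
  0 < r -> (forall z, Cmod z = r -> holomorphic_at f z) ->
  ex_RInt (fun theta => Re (f (polar r theta))) (- PI) PI.
Proof.
intros Hr Hf; rewrite <- (exp_ln r Hr).
apply (ex_RInt_vertical (fun s theta => Re (f (polar (exp s) theta)))
  (fun s theta => Im (f (polar (exp s) theta)))).
- generalize PI_RGT_0; lra.
- intros theta _; apply holomorphic_at_conjugate_at, Hf.
  rewrite Cmod_polar, exp_ln; [ reflexivity | exact Hr | left; apply exp_pos ].
Qed.

Lemma circle_integral_bound (f : C -> C) (r K : R) :
  0 < r -> (forall z, Cmod z = r -> holomorphic_at f z) ->
  (forall z, Cmod z = r -> Cmod (f z) <= K) ->
  Rabs (circle_integral f r) <= 2 * PI * K.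
Proof.
intros Hr Hf HK; assert (HPI := PI_RGT_0).
replace (2 * PI * K) with ((PI - - PI) * K) by ring.
apply abs_RInt_le_const; [ lra | apply ex_circle_integral; assumption | ].
intros theta _; eapply Rle_trans; [ apply re_le_Cmod | apply HK ].
apply Cmod_polar; lra.
Qed.

(** * Cauchy's formula and the maximum principle in an annulus *)

(** The numerator [z] comes from [dz = i z dtheta] on a circle. *)
Definition cauchy_kernel (t : R) (z : C) : C := (z / (z - RtoC t))%C.

Lemma Cmod_minus_lower (z : C) (t : R) :
  0 <= t -> Cmod z - t <= Cmod (z - RtoC t) /\ t - Cmod z <= Cmod (z - RtoC t).
Proof.
intros Ht.
assert (Hm : Cmod (RtoC t) = t) by (rewrite Cmod_R; apply Rabs_pos_eq, Ht).
split.
- assert (H := Cmod_triangle (z - RtoC t) (RtoC t)).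
  replace (z - RtoC t + RtoC t)%C with z in H by ring; lra.
- assert (H := Cmod_triangle (- (z - RtoC t)) z).
  replace (- (z - RtoC t) + z)%C with (RtoC t) in H by ring.
  rewrite Cmod_opp in H; lra.
Qed.

Lemma neq_of_Cmod (z : C) (t : R) : 0 <= t -> Cmod z <> t -> z <> RtoC t.
Proof.
intros Ht Hz E; apply Hz; rewrite E, Cmod_R; apply Rabs_pos_eq, Ht.
Qed.

Lemma Cminus_neq_0 (z w : C) : z <> w -> (z - w)%C <> 0%C.
Proof. intros H E; apply H; apply Ceq_minus; exact E. Qed.

Lemma holomorphic_at_over_minus (f : C -> C) (t : R) (z : C) :
  z <> RtoC t -> holomorphic_at f z ->
  holomorphic_at (fun z => f z / (z - RtoC t))%C z.
Proof.
intros Hz Hf; apply holomorphic_at_div; [ | exact Hf | ].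
- apply Cminus_neq_0, Hz.
- apply holomorphic_at_minus;
    [ apply holomorphic_at_id | apply holomorphic_at_const ].
Qed.

Lemma cauchy_kernel_bound (t r : R) (z : C) :
  0 < r -> 0 < t -> r <> t -> Cmod z = r ->
  Cmod (cauchy_kernel t z) <= r / Rabs (r - t).
Proof.
intros Hr Ht Hrt Hz; unfold cauchy_kernel.
assert (Hz' : z <> RtoC t) by (apply neq_of_Cmod; lra).
rewrite Cmod_div by (apply Cminus_neq_0, Hz').
rewrite Hz; unfold Rdiv; apply Rmult_le_compat_l; [ lra | ].
apply Rinv_le_contravar; [ apply Rabs_pos_lt; lra | ].
destruct (Cmod_minus_lower z t) as [H1 H2]; [ lra | ].
apply Rabs_le; lra.
Qed.

(** Inside the pole the integral does not depend on the radius and tends to 0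
    with it. *)
Lemma circle_integral_kernel_inside (t r : R) :
  0 < r -> r < t -> circle_integral (cauchy_kernel t) r = 0.
Proof.
intros Hr Hrt; assert (HPI := PI_RGT_0).
assert (Hhol : forall z, Cmod z < t -> holomorphic_at (cauchy_kernel t) z).
{ intros z Hz; apply holomorphic_at_over_minus;
    [ apply neq_of_Cmod; lra | apply holomorphic_at_id ]. }
apply Rabs_eq_0, Rle_antisym; [ | apply Rabs_pos ].
apply le_epsilon; intros e He; rewrite Rplus_0_l.
set (r' := Rmin r (e * (t - r) / (2 * PI))).
assert (Hr'1 : r' <= r) by apply Rmin_l.
assert (Hr'2 : r' <= e * (t - r) / (2 * PI)) by apply Rmin_r.
assert (Hr'0 : 0 < r').
{ unfold r'; apply Rmin_pos; [ exact Hr | ].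
  apply Rdiv_lt_0_compat; [ apply Rmult_lt_0_compat; lra | lra ]. }
rewrite <- (circle_integral_const _ r' r Hr'0 Hr'1) by (intros; apply Hhol; lra).
apply Rle_trans with (2 * PI * (r' / (t - r))).
- apply circle_integral_bound; [ exact Hr'0 | intros; apply Hhol; lra | ].
  intros z Hz; eapply Rle_trans; [ apply (cauchy_kernel_bound t r'); lra | ].
  rewrite Rabs_left by lra; unfold Rdiv; apply Rmult_le_compat_l; [ lra | ].
  apply Rinv_le_contravar; lra.
- apply Rle_div_r in Hr'2; [ | lra ].
  replace (2 * PI * (r' / (t - r))) with (r' * (2 * PI) / (t - r)) by (field; lra).
  apply Rle_div_l; lra.
Qed.

(** Outside the pole the integral does not depend on the radius either, and the
    kernel is [1 + t / (z - t)], which tends to 1 at infinity. *)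
Lemma circle_integral_kernel_outside (t r : R) :
  0 < t -> t < r -> circle_integral (cauchy_kernel t) r = 2 * PI.
Proof.
intros Ht Htr; assert (HPI := PI_RGT_0).
assert (Hhol : forall z, t < Cmod z -> holomorphic_at (cauchy_kernel t) z).
{ intros z Hz; apply holomorphic_at_over_minus;
    [ apply neq_of_Cmod; lra | apply holomorphic_at_id ]. }
set (k1 := fun z : C => (RtoC t / (z - RtoC t))%C).
assert (Hhol1 : forall z, t < Cmod z -> holomorphic_at k1 z).
{ intros z Hz; apply (holomorphic_at_over_minus (fun _ => RtoC t));
    [ apply neq_of_Cmod; lra | apply holomorphic_at_const ]. }
apply Rminus_diag_uniq.
apply Rabs_eq_0, Rle_antisym; [ | apply Rabs_pos ].
apply le_epsilon; intros e He; rewrite Rplus_0_l.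
set (r' := Rmax r (t + 2 * PI * t / e)).
assert (Hr'1 : r <= r') by apply Rmax_l.
assert (Hr'2 : t + 2 * PI * t / e <= r') by apply Rmax_r.
assert (Hq : 0 < 2 * PI * t / e)
  by (apply Rdiv_lt_0_compat; [ apply Rmult_lt_0_compat; lra | lra ]).
assert (Hr0 : 0 < r) by lra.
rewrite (circle_integral_const _ r r' Hr0 Hr'1) by (intros; apply Hhol; lra).
replace (circle_integral (cauchy_kernel t) r' - 2 * PI)
  with (circle_integral k1 r').
- apply Rle_trans with (2 * PI * (t / (r' - t))).
  + apply circle_integral_bound; [ lra | intros; apply Hhol1; lra | ].
    intros z Hz; unfold k1.
    assert (Hz' : z <> RtoC t) by (apply neq_of_Cmod; lra).
    rewrite Cmod_div by (apply Cminus_neq_0, Hz').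
    rewrite Cmod_R, Rabs_pos_eq by lra.
    unfold Rdiv; apply Rmult_le_compat_l; [ lra | ].
    apply Rinv_le_contravar; [ lra | ].
    destruct (Cmod_minus_lower z t) as [H1 H2]; lra.
  + replace (2 * PI * (t / (r' - t))) with ((2 * PI * t) / (r' - t))
      by (field; lra).
    apply Rle_div_l; [ lra | ].
    assert (Hle : 2 * PI * t / e <= r' - t) by lra.
    apply Rle_div_l in Hle; lra.
- unfold circle_integral.
  rewrite (RInt_ext (fun theta => Re (k1 (polar r' theta)))
    (fun theta => Re (cauchy_kernel t (polar r' theta)) - 1)).
  + rewrite (RInt_minus (V := R_CompleteNormedModule)).
    * rewrite (RInt_const (V := R_CompleteNormedModule)).
      unfold minus, plus, opp, scal; simpl; unfold mult; simpl; ring.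
    * apply ex_circle_integral; [ lra | intros; apply Hhol; lra ].
    * apply (ex_RInt_const (V := R_NormedModule)).
  + intros theta _; set (z := polar r' theta).
    assert (Hz : (z - RtoC t)%C <> 0%C).
    { apply Cminus_neq_0, neq_of_Cmod; [ lra | ].
      unfold z; rewrite Cmod_polar; lra. }
    replace (k1 z) with (cauchy_kernel t z - RtoC 1)%C.
    * unfold Re; simpl; ring.
    * unfold k1, cauchy_kernel; field; exact Hz.
Qed.

(** The residue theorem for [h z / (z - t) * z], obtained by removing the pole:
    [(h z - h t) / (z - t) * z] stays bounded near [t]. *)
Lemma circle_integral_cauchy (h : C -> C) (t r R' rho : R) :
  0 < r -> r < t -> t < R' ->
  (forall z : C, z <> 0%C -> holomorphic_at h z) -> h (RtoC t) = RtoC rho ->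
  circle_integral (fun z => h z * cauchy_kernel t z)%C R' -
  circle_integral (fun z => h z * cauchy_kernel t z)%C r = 2 * PI * rho.
Proof.
intros Hr Hrt Htr Hh Hrho.
assert (Hnz : forall z, r <= Cmod z -> z <> 0%C)
  by (intros z Hz; apply Cmod_gt_0; lra).
assert (HK : forall z, z <> RtoC t -> holomorphic_at (cauchy_kernel t) z)
  by (intros z Hz; apply holomorphic_at_over_minus;
      [ exact Hz | apply holomorphic_at_id ]).
set (F := fun z => ((h z - RtoC rho) * cauchy_kernel t z)%C).
assert (HF : forall z, r <= Cmod z -> z <> RtoC t -> holomorphic_at F z).
{ intros z Hz Hz'.
  apply (holomorphic_at_mult (fun z => h z - RtoC rho)%C); [ | apply HK, Hz' ].
  apply (holomorphic_at_minus h (fun _ => RtoC rho));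
    [ apply Hh, Hnz, Hz | apply holomorphic_at_const ]. }
assert (HhK : forall z, r <= Cmod z -> z <> RtoC t ->
  holomorphic_at (fun z => h z * cauchy_kernel t z)%C z).
{ intros z Hz Hz'; apply (holomorphic_at_mult h (cauchy_kernel t));
    [ apply Hh, Hnz, Hz | apply HK, Hz' ]. }
assert (Hsplit : forall s, r <= s -> s <> t ->
  circle_integral F s = circle_integral (fun z => h z * cauchy_kernel t z)%C s
                        - rho * circle_integral (cauchy_kernel t) s).
{ intros s Hs Hst; unfold circle_integral.
  assert (Hz' : forall z, Cmod z = s -> z <> RtoC t)
    by (intros z Hz; apply neq_of_Cmod; lra).
  rewrite <- (RInt_scal (V := R_CompleteNormedModule)) by
    (apply ex_circle_integral; [ lra | intros z Hz; apply HK, Hz', Hz ]).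
  rewrite <- (RInt_minus (V := R_CompleteNormedModule)).
  - apply RInt_ext; intros theta _; set (z := polar s theta).
    unfold F, Re; simpl; unfold minus, plus, opp, scal; simpl; unfold mult; simpl.
    ring.
  - apply (ex_circle_integral (fun z => h z * cauchy_kernel t z)%C); [ lra | ].
    intros z Hz; apply HhK; [ lra | apply Hz', Hz ].
  - apply (ex_RInt_scal (V := R_NormedModule)).
    apply ex_circle_integral; [ lra | intros z Hz; apply HK, Hz', Hz ]. }
assert (HE : circle_integral F r = circle_integral F R').
{ destruct (Hh (RtoC t)) as [l Hl].
  { apply Hnz; rewrite Cmod_R, Rabs_pos_eq; lra. }
  destruct (is_derive_C_elim' h _ _ Hl (mkposreal 1 Rlt_0_1)) as [d Hd].
  simpl in Hd.
  apply (circle_integral_const_punctured F t r R' ((Cmod l + 1) * (t + d)) d);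
    [ exact Hr | exact Hrt | exact Htr | apply cond_pos
    | intros; apply HF; [ apply H | assumption ] | ].
  intros z Hz Hzd; specialize (Hd z Hzd).
  assert (Hz0 : (z - RtoC t)%C <> 0%C) by (apply Cminus_neq_0, Hz).
  unfold F, cauchy_kernel; rewrite <- Hrho.
  replace ((h z - h (RtoC t)) * (z / (z - RtoC t)))%C
    with ((h z - h (RtoC t)) / (z - RtoC t) * z)%C by (field; exact Hz0).
  rewrite Cmod_mult, Cmod_div by exact Hz0.
  assert (Hzp : 0 < Cmod (z - RtoC t)) by (apply Cmod_gt_0, Hz0).
  apply Rmult_le_compat.
  - apply Rle_div_r; [ exact Hzp | rewrite Rmult_0_l; apply Cmod_ge_0 ].
  - apply Cmod_ge_0.
  - apply Rle_div_l; [ exact Hzp | ].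
    replace (h z - h (RtoC t))%C with
      ((h z - h (RtoC t) - (z - RtoC t) * l) + (z - RtoC t) * l)%C by ring.
    eapply Rle_trans; [ apply Cmod_triangle | rewrite Cmod_mult; lra ].
  - destruct (Cmod_minus_lower z t); lra. }
rewrite !Hsplit in HE by lra.
rewrite circle_integral_kernel_inside in HE by lra.
rewrite circle_integral_kernel_outside in HE by lra.
lra.
Qed.

Lemma cauchy_annulus_bound (g : C -> C) (t r R' A B : R) :
  0 < r -> r < t -> t < R' ->
  (forall z : C, z <> 0%C -> holomorphic_at g z) ->
  (forall z, Cmod z = R' -> Cmod (g z) <= A) ->
  (forall z, Cmod z = r -> Cmod (g z) <= B) ->
  Cmod (g (RtoC t)) <= A * (R' / (R' - t)) + B * (r / (t - r)).
Proof.
intros Hr Hrt Htr Hg HA HB; assert (HPI := PI_RGT_0).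
(* Rotating the values of g makes g t a nonnegative real number. *)
assert (Hc : exists c, Cmod c = 1 /\ (c * g (RtoC t))%C = RtoC (Cmod (g (RtoC t)))).
{ destruct (Ceq_dec (g (RtoC t)) 0) as [E|E].
  - exists 1%C; rewrite E, Cmod_1, Cmod_0; split; [ reflexivity | ring ].
  - assert (Hm : 0 < Cmod (g (RtoC t))) by (apply Cmod_gt_0, E).
    exists (RtoC (Cmod (g (RtoC t))) / g (RtoC t))%C; split.
    + rewrite Cmod_div, Cmod_R, Rabs_pos_eq by (assumption || lra); field; lra.
    + field; exact E. }
destruct Hc as (c & Hc1 & Hc2); set (rho := Cmod (g (RtoC t))) in *.
set (h := fun z => (c * g z)%C).
assert (Hh : forall z : C, z <> 0%C -> holomorphic_at h z).
{ intros z Hz; apply (holomorphic_at_mult (fun _ => c) g);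
    [ apply holomorphic_at_const | apply Hg, Hz ]. }
assert (Hhg : forall z, Cmod (h z) = Cmod (g z))
  by (intros z; unfold h; rewrite Cmod_mult, Hc1; ring).
assert (Hbound : forall s D, 0 < s -> s <> t ->
  (forall z, Cmod z = s -> Cmod (g z) <= D) ->
  Rabs (circle_integral (fun z => h z * cauchy_kernel t z)%C s)
    <= 2 * PI * (D * (s / Rabs (s - t)))).
{ intros s D Hs Hst HD; apply circle_integral_bound; [ exact Hs | | ].
  - intros z Hz; apply (holomorphic_at_mult h (cauchy_kernel t));
      [ apply Hh, Cmod_gt_0; lra | ].
    apply holomorphic_at_over_minus; [ apply neq_of_Cmod; lra | ].
    apply holomorphic_at_id.
  - intros z Hz; rewrite Cmod_mult, Hhg.
    apply Rmult_le_compat; try apply Cmod_ge_0; [ apply HD, Hz | ].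
    apply cauchy_kernel_bound; lra. }
assert (HR := Hbound R' A ltac:(lra) ltac:(lra) HA).
assert (Hr1 := Hbound r B Hr ltac:(lra) HB).
rewrite (Rabs_pos_eq (R' - t)) in HR by lra; rewrite (Rabs_left (r - t)) in Hr1 by lra.
replace (- (r - t)) with (t - r) in Hr1 by ring.
assert (HC := circle_integral_cauchy h t r R' rho Hr Hrt Htr Hh Hc2).
apply Rabs_le_between in HR; apply Rabs_le_between in Hr1.
apply Rmult_le_reg_l with (2 * PI); lra.
Qed.

(** The previous bound for the powers of [g] holds with a constant independent
    of the exponent, which therefore can be replaced by 1. *)
Lemma maximum_principle_annulus (g : C -> C) (t r R' A : R) :
  0 < r -> r < t -> t < R' ->
  (forall z : C, z <> 0%C -> holomorphic_at g z) ->
  (forall z, Cmod z = r \/ Cmod z = R' -> Cmod (g z) <= A) ->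
  Cmod (g (RtoC t)) <= A.
Proof.
intros Hr Hrt Htr Hg HA.
set (K := R' / (R' - t) + r / (t - r)).
assert (Hpow : forall n, Cmod (g (RtoC t)) ^ n <= A ^ n * K).
{ intros n; rewrite <- Cmod_pow; unfold K; rewrite Rmult_plus_distr_l.
  apply (cauchy_annulus_bound (fun z => g z ^ n)%C); try assumption.
  - intros z Hz; apply holomorphic_at_pow, Hg, Hz.
  - intros z Hz; rewrite Cmod_pow; apply pow_incr; split;
      [ apply Cmod_ge_0 | apply HA; right; exact Hz ].
  - intros z Hz; rewrite Cmod_pow; apply pow_incr; split;
      [ apply Cmod_ge_0 | apply HA; left; exact Hz ]. }
destruct (Rle_lt_dec (Cmod (g (RtoC t))) A) as [L|L]; [ exact L | exfalso ].
assert (HA0 : 0 <= A).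
{ apply Rle_trans with (Cmod (g (RtoC r))); [ apply Cmod_ge_0 | ].
  apply HA; left; rewrite Cmod_R; apply Rabs_pos_eq; lra. }
destruct HA0 as [HA0|HA0].
- set (q := Cmod (g (RtoC t)) / A).
  assert (Hq : 1 < q) by (unfold q; apply Rlt_div_r; lra).
  destruct (Pow_x_infinity q) with (b := K + 1) as [n Hn].
  { rewrite Rabs_pos_eq; lra. }
  specialize (Hn n (le_n n)).
  rewrite Rabs_pos_eq in Hn by (apply pow_le; lra).
  specialize (Hpow n).
  replace (Cmod (g (RtoC t))) with (A * q) in Hpow by (unfold q; field; lra).
  rewrite Rpow_mult_distr in Hpow.
  apply Rmult_le_reg_l in Hpow; [ lra | apply pow_lt, HA0 ].
- specialize (Hpow 1%nat); rewrite <- HA0 in *; simpl in Hpow; lra.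
Qed.

(** * Suprema and the weight of a sequence *)

Lemma real_Lub_Rbar_spec (E : R -> Prop) (y0 K : R) :
  E y0 -> (forall y, E y -> y <= K) ->
  (forall y, E y -> y <= real (Lub_Rbar E)) /\
  (forall L, (forall y, E y -> y <= L) -> real (Lub_Rbar E) <= L).
Proof.
intros H0 HK; destruct (Lub_Rbar_correct E) as [Hub Hl].
assert (Hfin : is_finite (Lub_Rbar E)).
{ generalize (Hub y0 H0) (Hl (Finite K) (fun y Hy => HK y Hy)).
  destruct (Lub_Rbar E); simpl; [ reflexivity | easy | easy ]. }
split.
- intros y Hy; specialize (Hub y Hy); rewrite <- Hfin in Hub; exact Hub.
- intros L HL; specialize (Hl (Finite L) (fun y Hy => HL y Hy)).
  rewrite <- Hfin in Hl; exact Hl.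
Qed.

Lemma real_Sup_seq_spec (a : nat -> R) (K : R) :
  (forall j, a j <= K) ->
  (forall j, a j <= real (Sup_seq (fun j => Finite (a j)))) /\
  (forall L, (forall j, a j <= L) -> real (Sup_seq (fun j => Finite (a j))) <= L).
Proof.
intros HK; generalize (Sup_seq_correct (fun j => Finite (a j))).
destruct (Sup_seq (fun j => Finite (a j))) as [l| |]; simpl; intros H.
- split.
  + intros j; apply le_epsilon; intros e He.
    left; apply (H (mkposreal e He)).
  + intros L HL; apply le_epsilon; intros e He.
    destruct (H (mkposreal e He)) as [_ [n Hn]]; simpl in Hn.
    specialize (HL n); lra.
- destruct (H K) as [n Hn]; specialize (HK n); lra.
- specialize (H (a 0%nat) 0%nat); lra.
Qed.

(** Boundedness of the terms makes [real] harmless in the definition of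
    [omega]. *)
Lemma inv_v_seq_spec (M : nat -> R) (t K : R) :
  0 < t -> (forall j, 0 < M j) -> (forall j, t ^ j / M j <= K) ->
  (forall j, t ^ j / M j <= / v_seq M t) /\
  (forall L, (forall j, t ^ j / M j <= L) -> / v_seq M t <= L).
Proof.
intros Ht HM HK.
assert (Hpos : forall j, 0 < t ^ j / M j)
  by (intros j; apply Rdiv_lt_0_compat; [ apply pow_lt, Ht | apply HM ]).
assert (Hln : forall L, (forall j, t ^ j / M j <= L) ->
  forall j, ln (t ^ j / M j) <= ln L).
{ intros L HL j; apply ln_le; [ apply Hpos | apply HL ]. }
destruct (real_Sup_seq_spec (fun j => ln (t ^ j / M j)) (ln K) (Hln K HK))
  as [Hub Hl].
unfold v_seq, omega; destruct (Rlt_dec 0 t) as [_|]; [ | contradiction ].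
rewrite exp_Ropp, Rinv_inv.
split.
- intros j; rewrite <- (exp_ln (t ^ j / M j)) by apply Hpos.
  apply exp_monotone, Hub.
- intros L HL; rewrite <- (exp_ln L).
  + apply exp_monotone, Hl, Hln, HL.
  + apply Rlt_le_trans with (1 := Hpos 0%nat), HL.
Qed.

(** This is the normalisation in the definition of [omega]; it agrees with the
    supremum of the terms only when [M 0 = 1]. *)
Lemma v_seq_0 (M : nat -> R) : v_seq M 0 = 1.
Proof.
unfold v_seq, omega; destruct (Rlt_dec 0 0); [ lra | ].
rewrite Ropp_0; apply exp_0.
Qed.

Lemma finite_upper_bound (a : nat -> R) (N : nat) :
  exists K, forall j, (j < N)%nat -> a j <= K.
Proof.
induction N as [|N [K HK]].
- exists 0; intros j Hj; lia.
- exists (Rmax K (a N)); intros j Hj.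
  destruct (Nat.eq_dec j N) as [->|Hn]; [ apply Rmax_r | ].
  apply Rle_trans with (2 := Rmax_l _ _), HK; lia.
Qed.

(** As soon as the j-th root of [M j] exceeds [t] the term is at most 1. *)
Lemma weight_sequence_terms_bounded (M : nat -> R) (t : R) :
  is_weight_sequence M -> 0 < t -> exists K, forall j, t ^ j / M j <= K.
Proof.
intros (HM & _ & Hlim) Ht.
apply is_lim_seq_spec in Hlim; destruct (Hlim t) as [N HN].
destruct (finite_upper_bound (fun j => t ^ j / M j) (S N)) as [K HK].
exists (Rmax K 1); intros j; destruct (Nat.lt_ge_cases j (S N)) as [L|L].
- apply Rle_trans with (2 := Rmax_l _ _), HK, L.
- apply Rle_trans with (2 := Rmax_r _ _).
  apply Rle_div_l; [ apply HM | rewrite Rmult_1_l ].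
  assert (Hj : 0 < INR j) by (apply lt_0_INR; lia).
  replace (M j) with (Rpower (M j) (/ INR j) ^ j).
  + apply pow_incr; specialize (HN j ltac:(lia)); lra.
  + rewrite <- Rpower_pow by apply exp_pos.
    rewrite Rpower_mult, Rinv_l, Rpower_1; [ reflexivity | apply HM | lra ].
Qed.

Lemma inv_v_seq_weight_sequence_spec (M : nat -> R) (t : R) :
  is_weight_sequence M -> 0 <= t ->
  (forall j, t ^ j / M j <= / v_seq M t) /\
  (forall L, (forall j, t ^ j / M j <= L) -> / v_seq M t <= L).
Proof.
intros HM [Ht|Ht].
- destruct (weight_sequence_terms_bounded M t HM Ht) as [K HK].
  apply (inv_v_seq_spec M t K Ht (proj1 HM) HK).
- rewrite <- Ht, v_seq_0, Rinv_1; destruct HM as (HM & HM0 & _); split.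
  + intros [|j]; simpl; [ rewrite HM0; lra | ].
    rewrite Rmult_0_l; unfold Rdiv; rewrite Rmult_0_l; lra.
  + intros L HL; specialize (HL 0%nat); rewrite HM0 in HL; simpl in HL; lra.
Qed.

Lemma pow_increment_bound (s t B : R) (j : nat) :
  0 <= s -> s <= t -> t <= B -> 1 <= B ->
  t ^ j - s ^ j <= (2 * B) ^ j * (t - s).
Proof.
intros Hs Hst HtB HB; induction j as [|j IH]; [ simpl; lra | ].
assert (H1 : s ^ j <= (2 * B) ^ j) by (apply pow_incr; lra).
assert (H2 : 0 <= s ^ j) by (apply pow_le, Hs).
assert (H3 : t * (t ^ j - s ^ j) <= B * ((2 * B) ^ j * (t - s))).
{ apply Rmult_le_compat; try lra.
  generalize (pow_incr s t j (conj Hs Hst)); lra. }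
assert (H4 : s ^ j * (t - s) <= B * ((2 * B) ^ j * (t - s))).
{ apply Rle_trans with ((2 * B) ^ j * (t - s)).
  - apply Rmult_le_compat_r; lra.
  - assert (0 <= (2 * B) ^ j * (t - s)) by (apply Rmult_le_pos; lra); nra. }
simpl; lra.
Qed.

(** On [0, B] the terms [t ^ j / M j] have the common Lipschitz constant
    [sup_j (2 B) ^ j / M j], which their supremum inherits; this supremum is at
    least 1, so its inverse has the same Lipschitz constant. *)
Lemma v_seq_lipschitz (M : nat -> R) (s t B : R) :
  is_weight_sequence M -> 0 <= s -> s <= t -> t <= B -> 1 <= B ->
  v_seq M t <= v_seq M s /\
  v_seq M s - v_seq M t <= / v_seq M (2 * B) * (t - s).
Proof.
intros HM Hs Hst HtB HB.
destruct (inv_v_seq_weight_sequence_spec M s HM Hs) as [Us Ls].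
destruct (inv_v_seq_weight_sequence_spec M t HM ltac:(lra)) as [Ut Lt].
destruct (inv_v_seq_weight_sequence_spec M (2 * B) HM ltac:(lra)) as [UB _].
destruct HM as (HM & HM0 & _).
assert (Ps : 0 < v_seq M s) by apply exp_pos.
assert (Pt : 0 < v_seq M t) by apply exp_pos.
assert (Hmono : / v_seq M s <= / v_seq M t).
{ apply Ls; intros j; apply Rle_trans with (2 := Ut j).
  apply Rmult_le_compat_r; [ left; apply Rinv_0_lt_compat, HM | ].
  apply pow_incr; lra. }
assert (Hlip : / v_seq M t <= / v_seq M s + / v_seq M (2 * B) * (t - s)).
{ apply Lt; intros j.
  apply Rle_trans with (s ^ j / M j + (2 * B) ^ j / M j * (t - s)).
  - replace (s ^ j / M j + (2 * B) ^ j / M j * (t - s))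
      with ((s ^ j + (2 * B) ^ j * (t - s)) / M j)
      by (field; apply Rgt_not_eq, HM).
    apply Rmult_le_compat_r; [ left; apply Rinv_0_lt_compat, HM | ].
    generalize (pow_increment_bound s t B j Hs Hst HtB HB); lra.
  - apply Rplus_le_compat; [ apply Us | ].
    apply Rmult_le_compat_r; [ lra | apply UB ]. }
assert (Hle : v_seq M t <= v_seq M s).
{ rewrite <- (Rinv_inv (v_seq M t)), <- (Rinv_inv (v_seq M s)).
  apply Rinv_le_contravar; [ apply Rinv_0_lt_compat, Ps | exact Hmono ]. }
assert (H1 : v_seq M s <= 1).
{ specialize (Us 0%nat); simpl in Us; rewrite HM0, Rdiv_1_r in Us.
  rewrite <- (Rinv_inv (v_seq M s)), <- Rinv_1.
  apply Rinv_le_contravar; lra. }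
split; [ exact Hle | ].
replace (v_seq M s - v_seq M t)
  with ((/ v_seq M t - / v_seq M s) * (v_seq M s * v_seq M t)) by (field; lra).
apply Rle_trans with ((/ v_seq M t - / v_seq M s) * 1); [ | lra ].
apply Rmult_le_compat_l; [ lra | nra ].
Qed.

Lemma is_weight_v_seq (M : nat -> R) : is_weight_sequence M -> is_weight (v_seq M).
Proof.
intros HM; split; [ | split; [ | split ] ].
- intros t _; apply exp_pos.
- intros t Ht.
  apply filterlim_locally; intros eps.
  set (B := t + 1); set (L := / v_seq M (2 * B)).
  assert (HL : 0 < L) by (apply Rinv_0_lt_compat, exp_pos).
  assert (Hd : 0 < Rmin 1 (eps / (2 * L))).
  { apply Rmin_pos; [ lra | apply Rdiv_lt_0_compat; [ apply cond_pos | lra ] ]. }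
  exists (mkposreal _ Hd); intros s Hs Hs0.
  change (Rabs (s - t) < Rmin 1 (eps / (2 * L))) in Hs.
  change (Rabs (v_seq M s - v_seq M t) < eps).
  assert (Hs1 := Rlt_le_trans _ _ _ Hs (Rmin_l _ _)).
  assert (Hs2 := Rlt_le_trans _ _ _ Hs (Rmin_r _ _)).
  assert (He := cond_pos eps).
  assert (Hlt : L * Rabs (s - t) < eps).
  { apply Rlt_div_r in Hs2; [ | lra ].
    generalize (Rabs_pos (s - t)); nra. }
  apply Rle_lt_trans with (2 := Hlt).
  apply Rabs_lt_between in Hs1.
  destruct (Rle_lt_dec s t) as [Hst|Hst].
  + destruct (v_seq_lipschitz M s t B HM Hs0 Hst) as [H1 H2];
      [ unfold B; lra | unfold B; lra | ].
    rewrite Rabs_pos_eq by lra; rewrite Rabs_left1 by lra.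
    fold L in H2; lra.
  + destruct (v_seq_lipschitz M t s B HM Ht) as [H1 H2];
      [ lra | unfold B; lra | unfold B; lra | ].
    rewrite Rabs_left1 by lra; rewrite Rabs_pos_eq by lra.
    fold L in H2; lra.
- intros s t Hs Hst.
  apply (v_seq_lipschitz M s t (t + 1) HM Hs Hst); lra.
- intros k; apply is_lim_spec; intros eps.
  assert (HMk : 0 < M (S k)) by apply HM.
  exists (Rmax 1 (M (S k) / eps)); intros t Ht.
  assert (Ht1 := Rle_lt_trans _ _ _ (Rmax_l _ _) Ht).
  assert (Ht2 := Rle_lt_trans _ _ _ (Rmax_r _ _) Ht).
  assert (He := cond_pos eps).
  destruct (inv_v_seq_weight_sequence_spec M t HM ltac:(lra)) as [U _].
  specialize (U (S k)); simpl in U.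
  assert (Pt : 0 < v_seq M t) by apply exp_pos.
  assert (Pk : 0 < t ^ k) by (apply pow_lt; lra).
  rewrite Rminus_0_r, Rabs_pos_eq by (apply Rmult_le_pos; lra).
  apply Rmult_lt_reg_r with t; [ lra | ].
  apply Rle_lt_trans with (M (S k)).
  + apply Rle_div_l in U; [ | exact HMk ].
    apply Rmult_le_reg_l with (/ v_seq M t); [ apply Rinv_0_lt_compat, Pt | ].
    replace (/ v_seq M t * (t ^ k * v_seq M t * t)) with (t * t ^ k)
      by (field; lra).
    exact U.
  + apply Rlt_div_l in Ht2; [ lra | exact He ].
Qed.

(** * The unit ball and the associated growth condition *)

Lemma Cmod_RtoC_nonneg (t : R) : 0 <= t -> Cmod (RtoC t) = t.
Proof. intros Ht; rewrite Cmod_R; apply Rabs_pos_eq, Ht. Qed.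

Lemma w_of_pos (v : R -> R) (t : R) : is_weight v -> 0 <= t -> 0 < w_of v t.
Proof. intros Hv Ht; apply Rinv_0_lt_compat, Hv, Ht. Qed.

Lemma unit_ball_monomial (w : R -> R) (j : nat) (m : R) :
  0 < m -> (forall t, 0 <= t -> t ^ j / m <= w t) ->
  unit_ball w (fun z => z ^ j / RtoC m)%C.
Proof.
intros Hm Hw; assert (Hm0 : RtoC m <> 0%C).
{ intros E; apply RtoC_inj in E; lra. }
split.
- apply entire_iff; intros z.
  apply (holomorphic_at_div (fun z => z ^ j)%C (fun _ => RtoC m)); [ exact Hm0 | | ].
  + apply (holomorphic_at_pow (fun z => z)), holomorphic_at_id.
  + apply holomorphic_at_const.
- intros z; rewrite Cmod_div, Cmod_pow, (Cmod_RtoC_nonneg m) by (exact Hm0 || lra).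
  apply Hw, Cmod_ge_0.
Qed.

Lemma unit_ball_const (v : R -> R) : is_weight v ->
  unit_ball (w_of v) (fun z => z ^ 0 / RtoC (v 0))%C.
Proof.
intros Hv; apply unit_ball_monomial; [ apply Hv; lra | intros t Ht ].
simpl; unfold Rdiv; rewrite Rmult_1_l; apply Rinv_le_contravar; apply Hv; lra.
Qed.

Lemma w_tilde_spec (v : R -> R) (t : R) : is_weight v -> 0 <= t ->
  (forall f, unit_ball (w_of v) f -> Cmod (f (RtoC t)) <= w_tilde v (RtoC t)) /\
  (forall L, (forall f, unit_ball (w_of v) f -> Cmod (f (RtoC t)) <= L) ->
     w_tilde v (RtoC t) <= L).
Proof.
intros Hv Ht; unfold w_tilde.
destruct (real_Lub_Rbar_spec (fun y => exists f : C -> C,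
    unit_ball (w_of v) f /\ y = Cmod (f (RtoC t))) _ (w_of v t)
    (ex_intro _ _ (conj (unit_ball_const v Hv) eq_refl))) as [Hub Hl].
- intros y (f & [_ Hf] & ->).
  specialize (Hf (RtoC t)); rewrite (Cmod_RtoC_nonneg t Ht) in Hf; exact Hf.
- split.
  + intros f Hf; apply Hub; exists f; split; [ exact Hf | reflexivity ].
  + intros L HL; apply Hl; intros y (f & Hf & ->); apply HL, Hf.
Qed.

Lemma w_tilde_le (v : R -> R) (t : R) :
  is_weight v -> 0 <= t -> w_tilde v (RtoC t) <= w_of v t.
Proof.
intros Hv Ht; apply (w_tilde_spec v t Hv Ht); intros f [_ Hf].
specialize (Hf (RtoC t)); rewrite (Cmod_RtoC_nonneg t Ht) in Hf; exact Hf.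
Qed.

Lemma monomial_le_w_tilde (v : R -> R) (j : nat) (m t : R) :
  is_weight v -> 0 < m -> (forall s, 0 <= s -> s ^ j / m <= w_of v s) ->
  0 <= t -> t ^ j / m <= w_tilde v (RtoC t).
Proof.
intros Hv Hm Hle Ht.
assert (H := proj1 (w_tilde_spec v t Hv Ht) _ (unit_ball_monomial _ j m Hm Hle)).
simpl in H.
rewrite Cmod_div, Cmod_pow, !Cmod_RtoC_nonneg in H; try lra.
intros E; apply RtoC_inj in E; lra.
Qed.

Lemma w_tilde_pos (v : R -> R) (t : R) :
  is_weight v -> 0 <= t -> 0 < w_tilde v (RtoC t).
Proof.
intros Hv Ht; assert (H0 : 0 < v 0) by (apply Hv; lra).
apply Rlt_le_trans with (t ^ 0 / v 0).
- apply Rdiv_lt_0_compat; simpl; lra.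
- apply monomial_le_w_tilde; [ exact Hv | exact H0 | | exact Ht ].
  intros s Hs; simpl; unfold Rdiv; rewrite Rmult_1_l.
  apply Rinv_le_contravar; apply Hv; lra.
Qed.

(** The monomials [z ^ j / M j] already exhaust the growth of [1 / v_seq M]. *)
Lemma v_tilde_v_seq (M : nat -> R) (t : R) :
  is_weight_sequence M -> 0 <= t -> v_seq M t = v_tilde (v_seq M) t.
Proof.
intros HM Ht; assert (Hv := is_weight_v_seq M HM).
unfold v_tilde; rewrite <- (Rinv_inv (v_seq M t)) at 1; f_equal.
apply Rle_antisym; [ | exact (w_tilde_le _ t Hv Ht) ].
apply (inv_v_seq_weight_sequence_spec M t HM Ht); intros j.
apply monomial_le_w_tilde; [ exact Hv | apply HM | | exact Ht ].
intros s Hs; apply (inv_v_seq_weight_sequence_spec M s HM Hs).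
Qed.

Lemma preceq_iff_inv (v w : R -> R) :
  (forall t, 0 <= t -> 0 < v t) -> (forall t, 0 <= t -> 0 < w t) ->
  (preceq v w <-> exists K, 1 <= K /\ forall t, 0 <= t -> / v t <= K * / w t).
Proof.
intros Hv Hw; split; intros (K & HK & H); exists K; split; try exact HK;
  intros t Ht; specialize (H t Ht); specialize (Hv t Ht); specialize (Hw t Ht).
- apply Rmult_le_reg_r with (v t * w t); [ apply Rmult_lt_0_compat; assumption | ].
  replace (/ v t * (v t * w t)) with (w t) by (field; lra).
  replace (K * / w t * (v t * w t)) with (K * v t) by (field; lra).
  exact H.
- apply Rmult_le_reg_r with (/ v t * / w t);
    [ apply Rmult_lt_0_compat; apply Rinv_0_lt_compat; assumption | ].
  replace (w t * (/ v t * / w t)) with (/ v t) by (field; lra).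
  replace (K * v t * (/ v t * / w t)) with (K * / w t) by (field; lra).
  exact H.
Qed.

Lemma essential_iff (u : R -> R) : is_weight u ->
  (essential u <->
   exists K, 1 <= K /\ forall t, 0 <= t -> w_of u t <= K * w_tilde u (RtoC t)).
Proof.
intros Hu.
assert (Hpos : forall t, 0 <= t -> 0 < v_tilde u t)
  by (intros t Ht; apply Rinv_0_lt_compat, w_tilde_pos; assumption).
assert (Hinv : forall t, / v_tilde u t = w_tilde u (RtoC t))
  by (intros t; apply Rinv_inv).
assert (Hup := proj1 Hu).
split.
- intros (_ & H & _); apply preceq_iff_inv in H; [ | assumption | assumption ].
  destruct H as (K & HK & H); exists K; split; [ exact HK | ].
  intros t Ht; specialize (H t Ht); rewrite Hinv in H; exact H.
- intros (K & HK & H); split; [ exact Hu | split ];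
    apply preceq_iff_inv; try assumption.
  + exists K; split; [ exact HK | ].
    intros t Ht; rewrite Hinv; apply H, Ht.
  + exists 1; split; [ lra | intros t Ht ].
    rewrite Hinv, Rmult_1_l; apply w_tilde_le; assumption.
Qed.

(** * The associated sequence *)

Lemma assoc_seq_spec (u : R -> R) (j : nat) : is_weight u ->
  (forall t, 0 < t -> t ^ j * u t <= assoc_seq u j) /\
  (forall L, (forall t, 0 < t -> t ^ j * u t <= L) -> assoc_seq u j <= L).
Proof.
intros Hu; destruct Hu as (Hpos & _ & Hdec & Hlim).
specialize (Hlim j); apply is_lim_spec in Hlim.
destruct (Hlim (mkposreal 1 Rlt_0_1)) as [T HT]; simpl in HT.
destruct (real_Lub_Rbar_spec (fun y => exists t : R, 0 < t /\ y = t ^ j * u t)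
  (1 ^ j * u 1) (Rmax 1 (Rmax 0 T ^ j * u 0))) as [Hub Hl].
- exists 1; split; [ lra | reflexivity ].
- intros y (t & Ht & ->); destruct (Rle_lt_dec t T) as [L|L].
  + apply Rle_trans with (2 := Rmax_r _ _).
    apply Rmult_le_compat.
    * apply pow_le; lra.
    * left; apply Hpos; lra.
    * apply pow_incr; split; [ lra | apply Rle_trans with (1 := L), Rmax_r ].
    * apply Hdec; lra.
  + apply Rle_trans with (2 := Rmax_l _ _).
    specialize (HT t L); rewrite Rminus_0_r in HT.
    apply Rabs_lt_between in HT; lra.
- split.
  + intros t Ht; apply Hub; exists t; split; [ exact Ht | reflexivity ].
  + intros L HL; apply Hl; intros y (t & Ht & ->); apply HL, Ht.
Qed.

Lemma assoc_seq_pos (u : R -> R) (j : nat) : is_weight u -> 0 < assoc_seq u j.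
Proof.
intros Hu; apply Rlt_le_trans with (1 ^ j * u 1).
- rewrite pow1, Rmult_1_l; apply Hu; lra.
- apply (assoc_seq_spec u j Hu); lra.
Qed.

(** The supremum defining [assoc_seq u 0] omits [t = 0]; continuity of [u] at 0
    recovers the missing value. *)
Lemma assoc_seq_0_ge (u : R -> R) : is_weight u -> u 0 <= assoc_seq u 0.
Proof.
intros Hu; apply le_epsilon; intros e He.
assert (Hc := proj1 (proj2 Hu) 0 (Rle_refl 0)).
destruct (proj1 (filterlim_locally _ _) Hc (mkposreal e He)) as [d Hd].
assert (Hd0 := cond_pos d).
assert (Hb : Rabs (u (d / 2) - u 0) < e).
{ apply (Hd (d / 2)); [ | lra ].
  change (Rabs (d / 2 - 0) < d); rewrite Rminus_0_r, Rabs_pos_eq; lra. }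
assert (H := proj1 (assoc_seq_spec u 0 Hu) (d / 2) ltac:(lra)); simpl in H.
apply Rabs_lt_between in Hb; lra.
Qed.

Lemma assoc_seq_term_le (u : R -> R) (j : nat) (t : R) :
  is_weight u -> 0 <= t -> t ^ j / assoc_seq u j <= w_of u t.
Proof.
intros Hu Ht; assert (Hut : 0 < u t) by (apply Hu; lra).
apply Rle_div_l; [ apply assoc_seq_pos, Hu | ].
apply Rmult_le_reg_r with (u t); [ exact Hut | ].
replace (w_of u t * assoc_seq u j * u t) with (assoc_seq u j)
  by (unfold w_of; field; lra).
destruct Ht as [Ht|<-]; [ apply (assoc_seq_spec u j Hu), Ht | ].
destruct j as [|j].
- simpl; rewrite Rmult_1_l; apply assoc_seq_0_ge, Hu.
- simpl; rewrite !Rmult_0_l; left; apply assoc_seq_pos, Hu.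
Qed.

Lemma inv_v_seq_assoc_spec (u : R -> R) (t : R) : is_weight u -> 0 < t ->
  (forall j, t ^ j / assoc_seq u j <= / v_seq (assoc_seq u) t) /\
  (forall L, (forall j, t ^ j / assoc_seq u j <= L) -> / v_seq (assoc_seq u) t <= L).
Proof.
intros Hu Ht; apply (inv_v_seq_spec (assoc_seq u) t (w_of u t) Ht).
- intros j; apply assoc_seq_pos, Hu.
- intros j; apply assoc_seq_term_le; [ exact Hu | lra ].
Qed.

(** At 0, where [v_seq] is normalised to 1, the two sides differ by a constant
    factor only. *)
Lemma sim_assoc_iff (u : R -> R) : is_weight u ->
  (sim u (v_seq (assoc_seq u)) <->
   exists K, 1 <= K /\ forall t, 0 < t -> w_of u t <= K * / v_seq (assoc_seq u) t).
Proof.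
intros Hu; assert (Hup := proj1 Hu).
assert (Hvp : forall t, 0 <= t -> 0 < v_seq (assoc_seq u) t)
  by (intros; apply exp_pos).
split.
- intros [H _]; apply preceq_iff_inv in H; try assumption.
  destruct H as (K & HK & H); exists K; split; [ exact HK | ].
  intros t Ht; apply H; lra.
- intros (K & HK & H); split; apply preceq_iff_inv; try assumption.
  + exists (Rmax K (w_of u 0)); split.
    * apply Rle_trans with (1 := HK), Rmax_l.
    * intros t [Ht|<-].
      -- apply Rle_trans with (1 := H t Ht), Rmult_le_compat_r; [ | apply Rmax_l ].
         left; apply Rinv_0_lt_compat, Hvp; lra.
      -- rewrite v_seq_0, Rinv_1, Rmult_1_r; apply Rmax_r.
  + exists (Rmax 1 (u 0)); split; [ apply Rmax_l | ].
    intros t [Ht|<-].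
    * apply Rle_trans with (w_of u t).
      -- apply (inv_v_seq_assoc_spec u t Hu Ht); intros j.
         apply assoc_seq_term_le; [ exact Hu | lra ].
      -- rewrite <- (Rmult_1_l (w_of u t)).
         apply Rmult_le_compat_r; [ left; apply (w_of_pos u); [ exact Hu | lra ] | ].
         apply Rmax_l.
    * assert (H0 : 0 < u 0) by (apply Hup; lra).
      rewrite v_seq_0, Rinv_1; apply Rmult_le_reg_r with (u 0); [ exact H0 | ].
      rewrite Rmult_assoc, Rinv_l by lra; rewrite Rmult_1_l, Rmult_1_r.
      apply Rmax_r.
Qed.

(** The monomials [z ^ j / assoc_seq u j] lie in the unit ball. *)
Lemma inv_v_seq_assoc_le_w_tilde (u : R -> R) (t : R) : is_weight u -> 0 < t ->
  / v_seq (assoc_seq u) t <= w_tilde u (RtoC t).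
Proof.
intros Hu Ht; apply (inv_v_seq_assoc_spec u t Hu Ht); intros j.
apply monomial_le_w_tilde; [ exact Hu | apply assoc_seq_pos, Hu | | lra ].
intros s Hs; apply assoc_seq_term_le; assumption.
Qed.

(** * Growth of the unit ball is captured by monomials *)

Lemma Cmod_div_pow_le (f : C -> C) (n : nat) (s X : R) (z : C) :
  0 < s -> Cmod z = s -> Cmod (f z) <= X * s ^ n -> Cmod (f z / z ^ n) <= X.
Proof.
intros Hs Hz Hf; assert (Hz0 : z <> 0%C) by (apply Cmod_gt_0; lra).
rewrite Cmod_div by (apply Cpow_nz, Hz0); rewrite Cmod_pow, Hz.
apply Rle_div_l; [ apply pow_lt, Hs | exact Hf ].
Qed.

(** At these radii [1 / u] is, up to a factor 2, touched from below by its best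
    monomial minorants of degrees [j] and [j + 1]. The degree [j] is chosen
    such that a radius of this kind exists up to [t] for [j] but not for [j + 1]. *)
Lemma consecutive_tangent_radii (u : R -> R) (t : R) : is_weight u -> 0 < t ->
  exists (j : nat) (r R' : R), 0 < r /\ r <= t /\ t < R' /\
    assoc_seq u j <= 2 * (r ^ j * u r) /\
    assoc_seq u (S j) <= 2 * (R' ^ S j * u R').
Proof.
intros Hu Ht; assert (Hpos := proj1 Hu).
assert (Hex : forall j, exists s, 0 < s /\ assoc_seq u j <= 2 * (s ^ j * u s)).
{ intros j; destruct (classic (exists s, 0 < s /\ assoc_seq u j <= 2 * (s ^ j * u s)))
    as [H|H]; [ exact H | exfalso ].
  assert (Hle : assoc_seq u j <= assoc_seq u j / 2).
  { apply (assoc_seq_spec u j Hu); intros s Hs.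
    destruct (Rle_lt_dec (assoc_seq u j) (2 * (s ^ j * u s))); [ | lra ].
    exfalso; apply H; exists s; split; assumption. }
  generalize (assoc_seq_pos u j Hu); lra. }
set (P := fun j => exists r, 0 < r /\ r <= t /\ assoc_seq u j <= 2 * (r ^ j * u r)).
assert (HP0 : P 0%nat).
{ destruct (Hex 0%nat) as (s & Hs & Hsu); exists (Rmin s t).
  split; [ apply Rmin_pos; assumption | split; [ apply Rmin_r | ] ].
  assert (u s <= u (Rmin s t)).
  { apply Hu; [ left; apply Rmin_pos; assumption | apply Rmin_l ]. }
  simpl in *; lra. }
(* Comparison with the value of u at 2 t shows that P fails for large j. *)
assert (HPn : exists N, ~ P N).
{ destruct (Pow_x_infinity 2) with (b := 2 * u 0 / u (2 * t) + 1) as [N HN].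
  { rewrite Rabs_pos_eq; lra. }
  exists N; intros (r & Hr & Hrt & Hru).
  specialize (HN N (le_n N)); rewrite Rabs_pos_eq in HN by (apply pow_le; lra).
  assert (H2 := proj1 (assoc_seq_spec u N Hu) (2 * t) ltac:(lra)).
  rewrite Rpow_mult_distr in H2.
  assert (Hp : 0 < t ^ N) by (apply pow_lt, Ht).
  assert (Hu2 : 0 < u (2 * t)) by (apply Hpos; lra).
  assert (H3 : r ^ N * u r <= t ^ N * u 0).
  { apply Rmult_le_compat; [ apply pow_le; lra | left; apply Hpos; lra | | ].
    - apply pow_incr; lra.
    - apply Hu; lra. }
  assert (H4 : 2 ^ N * u (2 * t) <= 2 * u 0).
  { apply Rmult_le_reg_l with (t ^ N); [ exact Hp | lra ]. }
  apply Rle_div_r in H4; [ lra | exact Hu2 ]. }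
assert (Hj : exists j, P j /\ ~ P (S j)).
{ destruct HPn as [N HN]; induction N as [|N IH]; [ contradiction | ].
  destruct (classic (P N)) as [H|H]; [ exists N; split; assumption | auto ]. }
destruct Hj as (j & (r & Hr & Hrt & Hru) & Hnot).
destruct (Hex (S j)) as (R' & HR & HRu).
exists j, r, R'; repeat split; try assumption.
apply Rnot_le_lt; intros H; apply Hnot; exists R'; repeat split; assumption.
Qed.

(** Let [r <= t < R'] be the tangent radii. Then [f / z ^ (j + 1)] and
    [f / z ^ j] are controlled on both circles by the terms of degrees [j] and
    [j + 1] of the supremum. Far from the circles Cauchy's formula in the annulus
    costs a bounded factor only; near one of them it degenerates, but there the
    maximum principle loses no more than the ratio of [t] to that radius, which
    is at most 2. *)
Lemma unit_ball_le_v_seq_assoc (u : R -> R) (f : C -> C) (t : R) :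
  is_weight u -> unit_ball (w_of u) f -> 0 < t ->
  Cmod (f (RtoC t)) <= 8 * / v_seq (assoc_seq u) t.
Proof.
intros Hu [Hf Hfu] Ht.
destruct (consecutive_tangent_radii u t Hu Ht)
  as (j & r & R' & Hr & Hrt & HtR & Hru & HRu).
destruct (inv_v_seq_assoc_spec u t Hu Ht) as [Hsup _].
assert (Ha := Hsup j); assert (Hb := Hsup (S j)).
set (S' := / v_seq (assoc_seq u) t) in *.
assert (HM0 := assoc_seq_pos u j Hu); assert (HM1 := assoc_seq_pos u (S j) Hu).
assert (HM0R := proj1 (assoc_seq_spec u j Hu) R' ltac:(lra)).
assert (HM1r := proj1 (assoc_seq_spec u (S j) Hu) r Hr).
set (M0 := assoc_seq u j) in *; set (M1 := assoc_seq u (S j)) in *.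
assert (Hur : 0 < u r) by (apply Hu; lra).
assert (HuR : 0 < u R') by (apply Hu; lra).
assert (Hwr : w_of u r <= 2 / M0 * r ^ j).
{ unfold w_of; apply Rmult_le_reg_r with (M0 * u r);
    [ apply Rmult_lt_0_compat; assumption | ].
  replace (/ u r * (M0 * u r)) with M0 by (field; lra).
  replace (2 / M0 * r ^ j * (M0 * u r)) with (2 * (r ^ j * u r)) by (field; lra).
  exact Hru. }
assert (HwR : w_of u R' <= 2 / M1 * R' ^ S j).
{ unfold w_of; apply Rmult_le_reg_r with (M1 * u R');
    [ apply Rmult_lt_0_compat; assumption | ].
  replace (/ u R' * (M1 * u R')) with M1 by (field; lra).
  replace (2 / M1 * R' ^ S j * (M1 * u R')) with (2 * (R' ^ S j * u R'))
    by (field; lra).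
  exact HRu. }
assert (HM1r' : r * M0 <= 2 * M1).
{ apply Rle_trans with (2 * (r * (r ^ j * u r))); [ nra | simpl in HM1r; lra ]. }
assert (HM0R' : M1 <= 2 * (R' * M0)).
{ apply Rle_trans with (1 := HRu); simpl; nra. }
assert (Hfz : forall z s, Cmod z = s -> Cmod (f z) <= w_of u s)
  by (intros z s <-; apply Hfu).
assert (Hhol : forall n (z : C), z <> 0%C -> holomorphic_at (fun z => f z / z ^ n)%C z).
{ intros n z Hz.
  apply (holomorphic_at_div f (fun z => z ^ n)%C); [ apply Cpow_nz, Hz | | ].
  - apply entire_iff, Hf.
  - apply (holomorphic_at_pow (fun z => z)), holomorphic_at_id. }
assert (Hmul : forall n X, Cmod (f (RtoC t) / RtoC t ^ n) <= X ->
  Cmod (f (RtoC t)) <= X * t ^ n).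
{ intros n X HX.
  assert (Ht0 : RtoC t <> 0%C) by (intros E; apply RtoC_inj in E; lra).
  rewrite Cmod_div in HX by (apply Cpow_nz, Ht0).
  rewrite Cmod_pow, Cmod_RtoC_nonneg in HX by lra.
  apply Rle_div_l in HX; [ exact HX | apply pow_lt, Ht ]. }
assert (Hstar : r = t \/ r < t) by lra.
destruct Hstar as [E|Hrt'].
{ apply Rle_trans with (1 := Hfz (RtoC t) t (Cmod_RtoC_nonneg t (Rlt_le _ _ Ht))).
  rewrite E in Hwr; apply Rle_trans with (1 := Hwr).
  assert (0 < t ^ j / M0) by (apply Rdiv_lt_0_compat; [ apply pow_lt, Ht | lra ]).
  unfold Rdiv in *; lra. }
destruct (Rlt_le_dec t (2 * r)) as [Hnear|Hfar].
(* t close to r: dividing by z ^ (j + 1) makes the inner circle dominate. *)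
{ apply Rle_trans with (4 / (r * M0) * t ^ S j).
  - apply Hmul.
    apply (maximum_principle_annulus (fun z => f z / z ^ S j)%C t r R');
      [ exact Hr | exact Hrt' | exact HtR | apply Hhol | ].
    intros z [Hz|Hz].
    + apply Cmod_div_pow_le with r; [ exact Hr | exact Hz | ].
      apply Rle_trans with (1 := Hfz z r Hz), Rle_trans with (1 := Hwr).
      replace (4 / (r * M0) * r ^ S j) with (4 / M0 * r ^ j) by (simpl; field; lra).
      apply Rmult_le_compat_r; [ apply pow_le; lra | ].
      apply Rmult_le_compat_r; [ left; apply Rinv_0_lt_compat; lra | lra ].
    + apply Cmod_div_pow_le with R'; [ lra | exact Hz | ].
      apply Rle_trans with (1 := Hfz z R' Hz), Rle_trans with (1 := HwR).
      apply Rmult_le_compat_r; [ apply pow_le; lra | ].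
      apply Rle_div_l; [ exact HM1 | ].
      replace (4 / (r * M0) * M1) with (4 * M1 / (r * M0)) by (field; lra).
      apply Rle_div_r; [ nra | lra ].
  - replace (4 / (r * M0) * t ^ S j) with (4 * (t / r) * (t ^ j / M0))
      by (simpl; field; lra).
    assert (Htr : t / r <= 2) by (apply Rle_div_l; lra).
    assert (0 < t ^ j / M0) by (apply Rdiv_lt_0_compat; [ apply pow_lt, Ht | lra ]).
    nra. }
destruct (Rlt_le_dec R' (2 * t)) as [HnearR|HfarR].
(* t close to R': dividing by z ^ j makes the outer circle dominate. *)
{ apply Rle_trans with (4 * R' / M1 * t ^ j).
  - apply Hmul.
    apply (maximum_principle_annulus (fun z => f z / z ^ j)%C t r R');
      [ exact Hr | exact Hrt' | exact HtR | apply Hhol | ].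
    intros z [Hz|Hz].
    + apply Cmod_div_pow_le with r; [ exact Hr | exact Hz | ].
      apply Rle_trans with (1 := Hfz z r Hz), Rle_trans with (1 := Hwr).
      apply Rmult_le_compat_r; [ apply pow_le; lra | ].
      apply Rle_div_l; [ exact HM0 | ].
      replace (4 * R' / M1 * M0) with (4 * (R' * M0) / M1) by (field; lra).
      apply Rle_div_r; [ exact HM1 | lra ].
    + apply Cmod_div_pow_le with R'; [ lra | exact Hz | ].
      apply Rle_trans with (1 := Hfz z R' Hz), Rle_trans with (1 := HwR).
      replace (4 * R' / M1 * R' ^ j) with (4 / M1 * R' ^ S j) by (simpl; field; lra).
      apply Rmult_le_compat_r; [ apply pow_le; lra | ].
      apply Rmult_le_compat_r; [ left; apply Rinv_0_lt_compat; lra | lra ].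
  - replace (4 * R' / M1 * t ^ j) with (4 * (R' / t) * (t ^ S j / M1))
      by (simpl; field; lra).
    assert (HRt : R' / t <= 2) by (apply Rle_div_l; lra).
    assert (0 < t ^ S j / M1) by (apply Rdiv_lt_0_compat; [ apply pow_lt, Ht | lra ]).
    nra. }
apply Rle_trans with
  ((2 / M1 * (R' / (R' - t)) + 2 / (r * M0) * (r / (t - r))) * t ^ S j).
- apply Hmul.
  apply (cauchy_annulus_bound (fun z => f z / z ^ S j)%C t r R');
    [ exact Hr | exact Hrt' | exact HtR | apply Hhol | | ].
  + intros z Hz; apply Cmod_div_pow_le with R'; [ lra | exact Hz | ].
    apply Rle_trans with (1 := Hfz z R' Hz), HwR.
  + intros z Hz; apply Cmod_div_pow_le with r; [ exact Hr | exact Hz | ].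
    apply Rle_trans with (1 := Hfz z r Hz), Rle_trans with (1 := Hwr).
    right; simpl; field; lra.
- replace ((2 / M1 * (R' / (R' - t)) + 2 / (r * M0) * (r / (t - r))) * t ^ S j)
    with (2 * (R' / (R' - t)) * (t ^ S j / M1) + 2 * (t / (t - r)) * (t ^ j / M0))
    by (simpl; field; lra).
  assert (H1 : R' / (R' - t) <= 2) by (apply Rle_div_l; lra).
  assert (H2 : t / (t - r) <= 2) by (apply Rle_div_l; lra).
  assert (0 < t ^ j / M0) by (apply Rdiv_lt_0_compat; [ apply pow_lt, Ht | lra ]).
  assert (0 < t ^ S j / M1) by (apply Rdiv_lt_0_compat; [ apply pow_lt, Ht | lra ]).
  nra.
Qed.

Theorem theorem3p4 :
  (forall M : nat -> R,
     is_weight_sequence M -> log_convex M ->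
     essential (v_seq M) /\
     (forall t : R, 0 <= t -> v_seq M t = v_tilde (v_seq M) t)) /\
  (forall u : R -> R,
     is_weight u ->
     (essential u <-> sim u (v_seq (assoc_seq u)))).
Proof.
split.
- intros M HM _; split; [ | intros t Ht; apply v_tilde_v_seq; assumption ].
  split; [ apply is_weight_v_seq, HM | ].
  split; exists 1; (split; [ lra | intros t Ht ]); rewrite Rmult_1_l; right;
    [ symmetry | ]; apply v_tilde_v_seq; assumption.
- intros u Hu; rewrite (essential_iff u Hu), (sim_assoc_iff u Hu).
  split; intros (K & HK & H).
  + exists (8 * K); split; [ lra | intros t Ht ].
    apply Rle_trans with (1 := H t (Rlt_le _ _ Ht)).
    rewrite (Rmult_comm 8), Rmult_assoc; apply Rmult_le_compat_l; [ lra | ].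
    apply (w_tilde_spec u t Hu (Rlt_le _ _ Ht)); intros f Hf.
    apply unit_ball_le_v_seq_assoc; assumption.
  + exists K; split; [ exact HK | intros t [Ht|<-] ].
    * apply Rle_trans with (1 := H t Ht), Rmult_le_compat_l; [ lra | ].
      apply inv_v_seq_assoc_le_w_tilde; assumption.
    * assert (H0 : 0 < u 0) by (apply Hu; lra).
      assert (Hc := proj1 (w_tilde_spec u 0 Hu (Rle_refl 0)) _
                      (unit_ball_const u Hu)); simpl in Hc.
      rewrite Cmod_div, Cmod_1, Cmod_RtoC_nonneg in Hc;
        [ | lra | intros E; apply RtoC_inj in E; lra ].
      assert (Hw := w_tilde_pos u 0 Hu (Rle_refl 0)).
      unfold w_of; rewrite Rdiv_1_l in Hc; nra.
Qed.
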